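(* For each $n\in\mathbb{N}$ there is a bijection between the set of equivalence classes of periodic orbits of period $2n$ on an equilateral triangle and the set of partitions of $n$ with $2$ and $3$ as parts (that is, partitions of $n$ all of whose parts lie in $\{2,3\}$; equivalently, pairs of nonnegative integers $(a,b)$ with $n=2a+3b$).
   Context: Billiards. Let $R$ be the closed region bounded by the equilateral triangle $\triangle ABC$. A nonsingular trajectory is a piecewise linear constant (nonzero) speed curve $\alpha:\mathbb{R}\to R$, moving in straight lines between successive strikes on the sides, reflecting at each strike so that the angle of incidence equals the angle of reflection, and never reaching a vertex. It is periodic if $\alpha(a+t)=\alpha(b+t)$ for some $a<b$ and all $t$; its restriction to $[a,b]$ is a periodic orbit. (Iterates are included.) The period is the number of strikes on the sides during the orbit (coinciding initial and final positions counted once). The angle of incidence at a strike is the (non-obtuse) angle between the path and the side struck. Unfoldings. Place $\triangle ABC$ with $\overline{BC}$ horizontal at the bottom, as a tile of a regular tessellation $\mathcal{T}$ of the plane by congruent equilateral triangles having one family of horizontal edges. Let $\alpha$ be a periodic orbit of period $m$. Every such orbit strikes a side at some point $P$ with angle of incidence in $[30^\circ,60^\circ]$; after relabelling vertices, changing the initial point and reversing the parameter if necessary, assume $P\in\overline{BC}$, $\alpha$ begins and ends at $P$, and both (Cartesian) components of the velocity on departure from $P$ are positive. Let $\alpha_1,\dots,\alpha_m$ be the successive directed segments of $\alpha$. Reflecting the triangle successively in the edges of $\mathcal{T}$ that the path meets, with reflections $\sigma_1,\dots,\sigma_{m-1}$ ($\sigma_1$ in the edge where $\alpha_1$ ends,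 $\sigma_2$ in the edge where $\sigma_1(\alpha_2)$ ends, etc.), the segments $\alpha_1,\sigma_1(\alpha_2),\dots,(\sigma_{m-1}\cdots\sigma_1)(\alpha_m)$ are collinear and their union is a directed segment $\underline{PQ}$ from $P$ to $Q=(\sigma_{m-1}\cdots\sigma_1)(P)$. Any directed segment so obtained is called an unfolding of $\alpha$. Equivalence. Periodic orbits $\alpha,\beta$ are equivalent if they have respective unfoldings $\underline{PQ}$, $\underline{RS}$ and there is a horizontal translation $\tau$ with $\underline{RS}=\tau(\underline{PQ})$. $[\alpha]$ denotes the equivalence class; its period is the period of its elements. A partition of $n$ is a nonincreasing sequence of nonnegative integers whose terms sum to $n$; its nonzero terms are its parts. *)

(* Defs.v *)
From Stdlib Require Import Reals Lra Lia ZArith List FinFun.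
Open Scope R_scope.

Definition point : Type := (R * R)%type.

Definition add (X Y : point) : point := (fst X + fst Y, snd X + snd Y).
Definition sub (X Y : point) : point := (fst X - fst Y, snd X - snd Y).
Definition scale (k : R) (X : point) : point := (k * fst X, k * snd X).
Definition dot (X Y : point) : R := fst X * fst Y + snd X * snd Y.
Definition norm (X : point) : R := sqrt (dot X X).
Definition distance (X Y : point) : R := norm (sub Y X).

Definition on_segment (E F X : point) : Prop :=
  exists s : R, 0 <= s <= 1 /\ X = add (scale (1 - s) E) (scale s F).

(* Mirror image of the vector [u] in the line through the origin spanned by
   [d]. *)
Definition mirror (d u : point) : point :=
  sub (scale (2 * (dot u d / dot d d)) d) u.

Definition reflect (E F X : point) : point :=
  add E (mirror (sub F E) (sub X E)).

(* Non-obtuse angle, in radians, between the lines spanned by [u] and [d]. *)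
Definition line_angle (u d : point) : R :=
  acos (Rabs (dot u d) / (norm u * norm d)).

Record Triangle : Type := mkTriangle { vA : point; vB : point; vC : point }.

Definition is_vertex (T : Triangle) (X : point) : Prop :=
  X = vA T \/ X = vB T \/ X = vC T.

Definition is_side (T : Triangle) (E F : point) : Prop :=
  (E = vA T /\ F = vB T) \/ (E = vB T /\ F = vC T) \/ (E = vC T /\ F = vA T).

Definition region (T : Triangle) (X : point) : Prop :=
  exists x y z : R, 0 <= x /\ 0 <= y /\ 0 <= z /\ x + y + z = 1 /\
    X = add (scale x (vA T)) (add (scale y (vB T)) (scale z (vC T))).

Definition boundary (T : Triangle) (X : point) : Prop :=
  exists E F : point, is_side T E F /\ on_segment E F X.

(* The strict inequality also makes an equilateral [T] nondegenerate. *)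
Definition equilateral_on_horizontal_base (T : Triangle) : Prop :=
  distance (vA T) (vB T) = distance (vB T) (vC T) /\
  distance (vB T) (vC T) = distance (vC T) (vA T) /\
  snd (vB T) = snd (vC T) /\ snd (vB T) < snd (vA T).

(* Isometries permuting the vertices: these realize the relabellings of an
   equilateral triangle, the relabelled triangle being put back in place. *)
Definition triangle_symmetry (T : Triangle) (g : point -> point) : Prop :=
  (forall X Y : point, distance (g X) (g Y) = distance X Y) /\
  (forall V : point, is_vertex T V -> is_vertex T (g V)).

Definition arrives (alpha : R -> point) (t : R) (u : point) : Prop :=
  exists eps : R, 0 < eps /\
    forall h : R, 0 <= h < eps -> alpha (t - h) = sub (alpha t) (scale h u).

Definition departs (alpha : R -> point) (t : R) (v : point) : Prop :=
  exists eps : R, 0 < eps /\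
    forall h : R, 0 <= h < eps -> alpha (t + h) = add (alpha t) (scale h v).

(* Piecewise linearity is expressed locally, by one-sided velocities; by
   compactness a bounded time interval splits into finitely many linear
   pieces. *)
Definition nonsingular_trajectory (T : Triangle) (alpha : R -> point) : Prop :=
  (forall t : R, region T (alpha t)) /\
  (forall t : R, ~ is_vertex T (alpha t)) /\
  exists speed : R, 0 < speed /\
    forall t : R, exists u v : point,
      arrives alpha t u /\ departs alpha t v /\
      norm u = speed /\ norm v = speed /\
      (~ boundary T (alpha t) -> v = u) /\
      (forall E F : point, is_side T E F -> on_segment E F (alpha t) ->
         v = mirror (sub F E) u).

(* [Orbit alpha a b] stands for the restriction of [alpha] to [[a, b]]. *)
Record orbit : Type := Orbit { path : R -> point; start : R; stop : R }.

Definition periodic_orbit (T : Triangle) (o : orbit) : Prop :=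
  nonsingular_trajectory T (path o) /\ start o < stop o /\
  forall t : R, path o (start o + t) = path o (stop o + t).

(* Strikes are counted as times, so a boundary point visited several times
   counts with multiplicity; the final time is excluded because the final
   position coincides with the initial one. *)
Definition has_period (T : Triangle) (o : orbit) (m : nat) : Prop :=
  exists l : list R, NoDup l /\ length l = m /\
    forall t : R, In t l <->
      (start o <= t < stop o /\ boundary T (path o t)).

(* Vertices and edges of the tessellation by congruent copies of the
   equilateral triangle [T] that has [T] as a tile. *)
Definition tess_vertex (T : Triangle) (X : point) : Prop :=
  exists i j : Z,
    X = add (vB T) (add (scale (IZR i) (sub (vC T) (vB T)))
                        (scale (IZR j) (sub (vA T) (vB T)))).

Definition tess_edge (T : Triangle) (E F : point) : Prop :=
  tess_vertex T E /\ tess_vertex T F /\ distance E F = distance (vB T) (vC T).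

(* [o'] arises from [o] by relabelling vertices, changing the initial point
   and possibly reversing the parameter. *)
Definition renormalized (T : Triangle) (o o' : orbit) : Prop :=
  exists g : point -> point, triangle_symmetry T g /\
    ((forall t : R, path o' t = g (path o t)) \/
     (forall t : R, path o' t = g (path o (- t)))) /\
    stop o' - start o' = stop o - start o.

Definition normal_start (T : Triangle) (o : orbit) : Prop :=
  on_segment (vB T) (vC T) (path o (start o)) /\
  (exists u : point, arrives (path o) (start o) u /\
     PI / 6 <= line_angle u (sub (vC T) (vB T)) <= PI / 3) /\
  (exists v : point, departs (path o) (start o) v /\ 0 < fst v /\ 0 < snd v).

(* [t 0 < ... < t m] are all the strike times of [o], from [start o] to
   [stop o]. *)
Definition strike_times (T : Triangle) (o : orbit) (m : nat) (t : nat -> R)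
  : Prop :=
  t 0%nat = start o /\ t m = stop o /\
  (forall k : nat, (k < m)%nat -> t k < t (S k)) /\
  (forall s : R, start o <= s <= stop o ->
     (boundary T (path o s) <-> exists k : nat, (k <= m)%nat /\ s = t k)).

(* The composite sigma_k ... sigma_1, where sigma_i is the reflection in
   [E i F i]. *)
Fixpoint unfold_map (E F : nat -> point) (k : nat) (X : point) : point :=
  match k with
  | O => X
  | S k' => reflect (E k) (F k) (unfold_map E F k' X)
  end.

(* [E k F k] is the edge of the tessellation in which the k-th unfolded
   segment ends, for k = 1, ..., m - 1. *)
Definition unfolds_to (T : Triangle) (o : orbit) (P Q : point) : Prop :=
  exists (m : nat) (t : nat -> R) (E F : nat -> point),
    strike_times T o m t /\
    (forall k : nat, (S k < m)%nat ->
       tess_edge T (E (S k)) (F (S k)) /\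
       on_segment (E (S k)) (F (S k))
         (unfold_map E F k (path o (t (S k))))) /\
    P = path o (start o) /\
    Q = unfold_map E F (m - 1) P.

(* A directed segment is given by its initial and final points. *)
Definition unfolding (T : Triangle) (o : orbit) (P Q : point) : Prop :=
  exists o' : orbit,
    renormalized T o o' /\ normal_start T o' /\ unfolds_to T o' P Q.

Definition orbit_equiv (T : Triangle) (o1 o2 : orbit) : Prop :=
  exists P Q R' S' : point,
    unfolding T o1 P Q /\ unfolding T o2 R' S' /\
    exists h : R, R' = add P (h, 0) /\ S' = add Q (h, 0).

Definition orbit_class (T : Triangle) (o : orbit) : orbit -> Prop :=
  fun o' => periodic_orbit T o' /\ orbit_equiv T o o'.

Definition is_class_of_period (T : Triangle) (m : nat) (c : orbit -> Prop)
  : Prop :=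
  exists o : orbit,
    periodic_orbit T o /\ has_period T o m /\ c = orbit_class T o.

(* Nonincreasing infinite sequences, the parts being followed by zeros. *)
Definition is_partition (n : nat) (p : nat -> nat) : Prop :=
  (forall i : nat, (p (S i) <= p i)%nat) /\
  exists N : nat,
    (forall i : nat, (N <= i)%nat -> p i = 0%nat) /\
    list_sum (map p (seq 0 N)) = n.

Definition parts_2_3 (p : nat -> nat) : Prop :=
  forall i : nat, p i <> 0%nat -> p i = 2%nat \/ p i = 3%nat.

(* Main.v *)
Require Import Defs.
From Stdlib Require Import Reals Lra Lia ZArith List FinFun Sorted Permutation.
From Stdlib Require Import Classical ClassicalEpsilon FunctionalExtensionality
  PropExtensionality.
Open Scope R_scope.

(** Take the left end of the base as origin and the two edges issuing from it as
    basis. In these lattice coordinates (i, j) the triangle is i, j >= 0,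
    i + j <= 1, the vertices of the tessellation are the integer points, and its
    edges lie on the mirrors, where one of j, i, i + j is an integer. The group W
    generated by the reflections in the mirrors consists of the maps l + (x, y),
    where l is one of six linear maps and x, y are integers with x = y modulo 3:
    the reflections preserve the colour i - j modulo 3 of an integer point.

    Unfolding. Follow the straight line L that leaves alpha(t0) with the velocity V
    of the trajectory. For every time t some element of W carries alpha(t) to L(t)
    and the velocity at t to V ([unfolding_line]): this holds at t0, and both it and
    its negation persist for a short time around each t, where a strike is absorbed
    by composition with the reflection in the side struck. Hence alpha strikes when
    L meets a mirror, L avoids the integer points, and the unfolded segment PQ is
    the part of L traversed during the orbit ([unfold_map_line]), so that Q - P is
    the duration times V.

    The class of an orbit is its vector. Every velocity of the orbit, also after a
    symmetry of the triangle and a reversal of time, is V up to the dihedral group of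
    order 12, which has the directions between 30 and 60 degrees as a fundamental
    domain. As the unfoldings are normalized to start in this sector from the base,
    they all have the same vector ([unfolding_vector_unique]), and two orbits are
    equivalent exactly when their vectors agree.

    The vectors. After one period the element w of W that unfolds the trajectory
    fixes V. Either w is a translation, and Q - P = (i, j) with 0 <= i <= j and
    i = j modulo 3, say i = a and j = a + 3b; L then meets j + i + (i + j) mirrors,
    so the period is 2 (2a + 3b). Or w is a glide reflection along a side direction,
    and then L meets an odd number of mirrors ([count_glide_strikes]), which an even
    period excludes. This is [period_vector].

    Conversely, folding into the triangle a line of direction (a, a + 3b) that starts
    on the base and misses the integer points gives an orbit with that vector
    ([folded_line_billiard], [periodic_billiard_exists]). So the classes of period 2n
    correspond to the pairs (a, b) with 2a + 3b = n, that is to the partitions of n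
    into a parts equal to 2 and b parts equal to 3. *)

(** * Continuous induction *)

(** The least upper bound of the x up to which Q holds on all of [a, x] satisfies Q
    by the limit clause, and would not be an upper bound below b by the step clause. *)
Lemma real_induction (Q : R -> Prop) (a b : R) :
  Q a ->
  (forall t, a <= t < b -> Q t ->
     exists e, 0 < e /\ forall s, t < s < t + e -> s <= b -> Q s) ->
  (forall t, a < t <= b -> (forall s, a <= s < t -> Q s) -> Q t) ->
  forall t, a <= t <= b -> Q t.
Proof.
  intros Ha Hstep Hlim t Ht.
  set (E := fun x => a <= x <= b /\ forall s, a <= s <= x -> Q s).
  assert (Ea : E a).
  { split; [lra|]. intros s Hs. replace s with a by lra. exact Ha. }
  destruct (completeness E) as [m [Hub Hleast]].
  { exists b. intros x [Hx _]. lra. }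
  { exists a. exact Ea. }
  assert (Ham : a <= m) by (apply Hub; exact Ea).
  assert (Hmb : m <= b) by (apply Hleast; intros x [Hx _]; lra).
  assert (Hlt : forall s, a <= s < m -> Q s).
  { intros s Hs. apply NNPP. intro HQ.
    assert (m <= s); [|lra].
    apply Hleast. intros x [Hx HxQ]. apply Rnot_lt_le. intro.
    apply HQ, HxQ. lra. }
  assert (Qm : Q m).
  { destruct (Req_dec m a) as [->|]; [exact Ha|]. apply Hlim; [lra|exact Hlt]. }
  assert (Hle : forall s, a <= s <= m -> Q s).
  { intros s Hs. destruct (Req_dec s m) as [->|]; [exact Qm|]. apply Hlt; lra. }
  destruct (Req_dec m b) as [->|Hneq]; [apply Hle; lra|].
  exfalso. destruct (Hstep m) as (e & He & Hs); [lra|exact Qm|].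
  set (x := Rmin b (m + e / 2)).
  assert (Hx : m < x <= b /\ x < m + e).
  { unfold x, Rmin. destruct (Rle_dec b (m + e / 2)); lra. }
  assert (x <= m); [|lra].
  apply Hub. split; [lra|]. intros s Hsx.
  destruct (Rle_lt_dec s m); [apply Hle; lra|apply Hs; lra].
Qed.

(** Connectedness of the line. A trajectory is described only near each time, and
    its strikes are not known in advance to be discrete; this carries information
    about one time to all times without enumerating them. *)
Lemma locally_constant_forall (Q : R -> Prop) :
  (forall t, exists e, 0 < e /\ forall s, Rabs (s - t) < e -> (Q s <-> Q t)) ->
  forall a b, Q a -> Q b.
Proof.
  assert (Hup : forall Q : R -> Prop,
    (forall t, exists e, 0 < e /\ forall s, Rabs (s - t) < e -> (Q s <-> Q t)) ->
    forall a b, a <= b -> Q a -> Q b).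
  { clear Q. intros Q H a b Hab Ha.
    apply (real_induction Q a b); trivial; [| |lra].
    - intros t _ Ht. destruct (H t) as (e & He & Hs). exists e. split; [exact He|].
      intros s Hs' _. apply Hs; [|exact Ht]. rewrite Rabs_right; lra.
    - intros t Ht Hall. destruct (H t) as (e & He & Hs).
      set (s := Rmax a (t - e / 2)).
      assert (a <= s < t /\ t - e < s).
      { unfold s, Rmax. destruct (Rle_dec a (t - e / 2)); lra. }
      apply (Hs s); [rewrite Rabs_left; lra|]. apply Hall. lra. }
  intros H a b Ha. destruct (Rle_lt_dec a b) as [Hab|Hab].
  - exact (Hup Q H a b Hab Ha).
  - rewrite <- (Ropp_involutive b).
    apply (Hup (fun t => Q (- t))) with (a := - a); [|lra|now rewrite Ropp_involutive].
    intro t. destruct (H (- t)) as (e & He & Hs). exists e. split; [exact He|].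
    intros s Hst. apply Hs. replace (- s - - t) with (- (s - t)) by ring.
    now rewrite Rabs_Ropp.
Qed.

(** * The tessellation in lattice coordinates and its reflection group *)

(** The three directions of mirrors: FBC is parallel to the base, FAB to the side
    from the left end of the base to the apex, FCA to the third side. *)
Inductive mirror_family : Type := FBC | FAB | FCA.

Definition height (k : mirror_family) (X : point) : R :=
  match k with FBC => snd X | FAB => fst X | FCA => fst X + snd X end.

Definition isZ (x : R) : Prop := exists n : Z, x = IZR n.

Definition lattice_point (X : point) : Prop := isZ (fst X) /\ isZ (snd X).

Definition in_tile (X : point) : Prop :=
  0 <= fst X /\ 0 <= snd X /\ fst X + snd X <= 1.

(** The linear parts of the reflection group: a copy of the symmetric group S3, with
    [Lmir k] the reflection in a mirror of direction k. *)
Inductive linpart : Type := Lid | Lrot | Lrot2 | Lmir (k : mirror_family).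

Definition lact (l : linpart) (X : point) : point :=
  let (i, j) := X in
  match l with
  | Lid => (i, j)
  | Lrot => (j, - i - j)
  | Lrot2 => (- i - j, i)
  | Lmir FBC => (i + j, - j)
  | Lmir FAB => (- i, i + j)
  | Lmir FCA => (- j, - i)
  end.

(** The translation part is (b + 3k, b). Its two components are congruent modulo 3
    because reflections preserve the colour i - j modulo 3 of a vertex, which tells
    the vertex of the tile onto which it folds; the parametrization by b and k builds
    the congruence in, so that W needs no side condition. *)
Record weyl : Type := Weyl { lin : linpart; tb : Z; tk : Z }.

Definition wact (w : weyl) (X : point) : point :=
  add (lact (lin w) X) (IZR (tb w + 3 * tk w), IZR (tb w)).

Ltac point_ring :=
  repeat match goal with X : point |- context [?Y] => constr_eq X Y; destruct X end;
  unfold wact, add, sub, scale; cbn [fst snd lact height lin tb tk] in *;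
  try (apply injective_projections; cbn [fst snd]);
  repeat rewrite ?plus_IZR, ?minus_IZR, ?mult_IZR, ?opp_IZR; try ring.

Lemma lact_add l X Y : lact l (add X Y) = add (lact l X) (lact l Y).
Proof. destruct l as [| | |[]]; point_ring. Qed.

Lemma lact_scale l c X : lact l (scale c X) = scale c (lact l X).
Proof. destruct l as [| | |[]]; point_ring. Qed.

Lemma lact_sub l X Y : lact l (sub X Y) = sub (lact l X) (lact l Y).
Proof. destruct l as [| | |[]]; point_ring. Qed.

Lemma lact_compose l l' : exists l'', forall X, lact l'' X = lact l (lact l' X).
Proof.
  destruct l as [| | |[]], l' as [| | |[]];
  first [exists Lid; intros []; point_ring; fail | exists Lrot; intros []; point_ring; fail
        | exists Lrot2; intros []; point_ring; fail
        | exists (Lmir FBC); intros []; point_ring; fail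
        | exists (Lmir FAB); intros []; point_ring; fail
        | exists (Lmir FCA); intros []; point_ring; fail].
Qed.

Lemma lact_inverse l : exists l', forall X, lact l' (lact l X) = X.
Proof.
  destruct l as [| | |k]; [exists Lid|exists Lrot2|exists Lrot|exists (Lmir k); destruct k];
  intros []; point_ring.
Qed.

Lemma lact_translation l b k : exists b' k',
  lact l (IZR (b + 3 * k), IZR b) = (IZR (b' + 3 * k'), IZR b').
Proof.
  destruct l as [| | |[]];
  [exists b, k|exists (- 2 * b - 3 * k)%Z, (b + k)%Z|exists (b + 3 * k)%Z, (- b - 2 * k)%Z
  |exists (- b)%Z, (b + k)%Z|exists (2 * b + 3 * k)%Z, (- b - 2 * k)%Z
  |exists (- b - 3 * k)%Z, k]; cbn [lact]; apply injective_projections; cbn [fst snd];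
  repeat rewrite ?plus_IZR, ?minus_IZR, ?mult_IZR, ?opp_IZR; try ring.
Qed.

Lemma wact_move w X h v :
  wact w (add X (scale h v)) = add (wact w X) (scale h (lact (lin w) v)).
Proof. unfold wact. rewrite lact_add, lact_scale. point_ring. Qed.

Lemma wact_compose w w' : exists w'',
  (forall X, wact w'' X = wact w (wact w' X)) /\
  (forall X, lact (lin w'') X = lact (lin w) (lact (lin w') X)).
Proof.
  destruct w as [l b k], w' as [l' b' k'].
  destruct (lact_compose l l') as [l'' Hl].
  destruct (lact_translation l b' k') as (b1 & k1 & H).
  exists (Weyl l'' (b1 + b) (k1 + k)). split; [|exact Hl].
  intro X. unfold wact; simpl lin; simpl tb; simpl tk.
  rewrite Hl, lact_add, H. generalize (lact l (lact l' X)); intro. point_ring.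
Qed.

Lemma wact_inverse w : exists w',
  (forall X, wact w' (wact w X) = X) /\
  (forall X, lact (lin w') (lact (lin w) X) = X).
Proof.
  destruct w as [l b k]. destruct (lact_inverse l) as [l' Hl].
  destruct (lact_translation l' b k) as (b1 & k1 & H).
  exists (Weyl l' (- b1) (- k1)). split; [|exact Hl].
  intro X. unfold wact; simpl lin; simpl tb; simpl tk.
  rewrite lact_add, Hl, H. point_ring.
Qed.

Lemma isZ_add_IZR x n : isZ (x + IZR n) <-> isZ x.
Proof.
  split; intros [m Hm].
  - exists (m - n)%Z. rewrite minus_IZR. lra.
  - exists (m + n)%Z. rewrite plus_IZR. lra.
Qed.

Lemma isZ_opp x : isZ (- x) <-> isZ x.
Proof. split; intros [m Hm]; exists (- m)%Z; rewrite opp_IZR; lra. Qed.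

(** The linear part l carries the mirrors of direction [lfam l k] to those of
    direction k. *)
Definition lfam (l : linpart) (k : mirror_family) : mirror_family :=
  match l, k with
  | Lid, _ => k
  | Lrot, FBC => FCA | Lrot, FAB => FBC | Lrot, FCA => FAB
  | Lrot2, FBC => FAB | Lrot2, FAB => FCA | Lrot2, FCA => FBC
  | Lmir FBC, FBC => FBC | Lmir FBC, FAB => FCA | Lmir FBC, FCA => FAB
  | Lmir FAB, FBC => FCA | Lmir FAB, FAB => FAB | Lmir FAB, FCA => FBC
  | Lmir FCA, FBC => FAB | Lmir FCA, FAB => FBC | Lmir FCA, FCA => FCA
  end.

Lemma height_lact l k X :
  height k (lact l X) = height (lfam l k) X \/
  height k (lact l X) = - height (lfam l k) X.
Proof.
  destruct X as [i j].
  destruct l as [| | |[]], k; simpl; first [left; ring | right; ring].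
Qed.

Lemma lfam_surj l k : exists k', lfam l k' = k.
Proof.
  destruct l as [| | |[]], k;
  first [now exists FBC | now exists FAB | now exists FCA].
Qed.

(** Conjugating a reflection by l gives the reflection in the image mirror. *)
Lemma mirror_conj l k v :
  lact (Lmir k) (lact l v) = lact l (lact (Lmir (lfam l k)) v).
Proof. destruct l as [| | |[]], k; destruct v; cbn [lfam]; point_ring. Qed.

Lemma mirror_involutive k v : lact (Lmir k) (lact (Lmir k) v) = v.
Proof. destruct k, v; point_ring. Qed.

Lemma isZ_height_wact w k X :
  isZ (height k (wact w X)) <-> isZ (height (lfam (lin w) k) X).
Proof.
  unfold wact.
  assert (H : exists n, height k (add (lact (lin w) X) (IZR (tb w + 3 * tk w), IZR (tb w)))
     = height k (lact (lin w) X) + IZR n).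
  { destruct k; cbn [height add fst snd].
    - now exists (tb w).
    - now exists (tb w + 3 * tk w)%Z.
    - exists (tb w + 3 * tk w + tb w)%Z. rewrite (plus_IZR _ (tb w)). ring. }
  destruct H as [n ->]. rewrite isZ_add_IZR.
  destruct (height_lact (lin w) k X) as [-> | ->]; [reflexivity|apply isZ_opp].
Qed.

(** Two of i, j, i + j being integers, so is the third. Hence a nonsingular
    trajectory is on one mirror only when it strikes, and the side struck is
    unambiguous. *)
Lemma two_families_lattice k k' X :
  k <> k' -> isZ (height k X) -> isZ (height k' X) -> lattice_point X.
Proof.
  destruct k, k', X as [i j]; simpl; intros Hk [n Hn] [m Hm]; try congruence;
  split; cbn [fst snd];
  first [exists n; lra | exists m; lra
        | exists (n - m)%Z; rewrite minus_IZR; lra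
        | exists (m - n)%Z; rewrite minus_IZR; lra].
Qed.

Lemma lattice_point_height k X : lattice_point X -> isZ (height k X).
Proof.
  destruct X as [i j]; intros [[n Hn] [m Hm]]; simpl in *; destruct k; simpl.
  - now exists m. - now exists n. - exists (n + m)%Z. rewrite plus_IZR; lra.
Qed.

Lemma lattice_point_wact w X : lattice_point (wact w X) <-> lattice_point X.
Proof.
  split; intro H.
  - destruct (lfam_surj (lin w) FBC) as [k1 H1].
    destruct (lfam_surj (lin w) FAB) as [k2 H2].
    split; [change (isZ (height FAB X)); rewrite <- H2
           |change (isZ (height FBC X)); rewrite <- H1];
    apply isZ_height_wact, lattice_point_height, H.
  - split; [change (isZ (height FAB (wact w X)))|change (isZ (height FBC (wact w X)))];
    apply isZ_height_wact, lattice_point_height, H.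
Qed.

(** The reflection in the mirror where the height of direction k equals n. *)
Definition mirror_in (k : mirror_family) (n : Z) : weyl :=
  match k with
  | FBC => Weyl (Lmir k) (2 * n) (- n)
  | FAB => Weyl (Lmir k) (- n) n
  | FCA => Weyl (Lmir k) n 0
  end.

Lemma lin_mirror_in k n : lin (mirror_in k n) = Lmir k.
Proof. now destruct k. Qed.

Lemma mirror_in_fixes k n X : height k X = IZR n -> wact (mirror_in k n) X = X.
Proof.
  destruct X as [i j]; destruct k; unfold wact, add;
  cbn [mirror_in lin tb tk lact height fst snd]; intro H;
  apply injective_projections; cbn [fst snd];
  repeat rewrite ?plus_IZR, ?mult_IZR, ?opp_IZR; lra.
Qed.

(** * One-sided velocities *)

Lemma scale_reg h u v : h <> 0 -> scale h u = scale h v -> u = v.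
Proof.
  destruct u as [a b], v as [c d]. unfold scale; cbn [fst snd]. intros Hh H.
  injection H as H1 H2. apply Rmult_eq_reg_l in H1, H2; congruence.
Qed.

Lemma add_reg X u v : add X u = add X v -> u = v.
Proof.
  destruct X, u, v. unfold add; cbn [fst snd]. intro H. injection H as H1 H2.
  apply injective_projections; cbn [fst snd]; lra.
Qed.

Lemma sub_reg X u v : sub X u = sub X v -> u = v.
Proof.
  destruct X, u, v. unfold sub; cbn [fst snd]. intro H. injection H as H1 H2.
  apply injective_projections; cbn [fst snd]; lra.
Qed.

(** Any small time positive for both descriptions determines the velocity. *)
Lemma departs_unique alpha t v v' :
  departs alpha t v -> departs alpha t v' -> v = v'.
Proof.
  intros (e & He & H) (e' & He' & H').
  set (h := Rmin e e' / 2).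
  assert (Hh : 0 < h < e /\ h < e').
  { unfold h, Rmin. destruct (Rle_dec e e'); lra. }
  apply (scale_reg h); [lra|]. apply (add_reg (alpha t)).
  rewrite <- H, <- H' by lra. reflexivity.
Qed.

Lemma arrives_unique alpha t u u' :
  arrives alpha t u -> arrives alpha t u' -> u = u'.
Proof.
  intros (e & He & H) (e' & He' & H').
  set (h := Rmin e e' / 2).
  assert (Hh : 0 < h < e /\ h < e').
  { unfold h, Rmin. destruct (Rle_dec e e'); lra. }
  apply (scale_reg h); [lra|]. apply (sub_reg (alpha t)).
  rewrite <- H, <- H' by lra. reflexivity.
Qed.

Lemma departs_persists alpha t v :
  departs alpha t v -> exists e, 0 < e /\ forall h, 0 <= h < e ->
    alpha (t + h) = add (alpha t) (scale h v) /\ departs alpha (t + h) v.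
Proof.
  intros (e & He & H). exists e. split; [exact He|]. intros h Hh.
  split; [now apply H|]. exists (e - h). split; [lra|]. intros h' Hh'.
  replace (t + h + h') with (t + (h + h')) by ring. rewrite !H by lra.
  generalize (alpha t). intro. point_ring.
Qed.

Lemma arrives_before alpha t u :
  arrives alpha t u -> exists e, 0 < e /\ forall h, 0 < h < e ->
    alpha (t - h) = sub (alpha t) (scale h u) /\ departs alpha (t - h) u.
Proof.
  intros (e & He & H). exists e. split; [exact He|]. intros h Hh.
  split; [apply H; lra|]. exists h. split; [lra|]. intros h' Hh'.
  replace (t - h + h') with (t - (h - h')) by ring. rewrite !H by lra.
  generalize (alpha t). intro. point_ring.
Qed.

(** * Billiards in lattice coordinates and their unfolding *)

(** A nonsingular trajectory read in lattice coordinates. In the tile without its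
    vertices a point is on the side of direction k exactly when its height k is an
    integer ([gap_lattice] below), which lets one clause state the reflection law for
    all sides in a form invariant under W. *)
Record lattice_billiard (alpha : R -> point) : Prop := {
  lb_tile : forall t, in_tile (alpha t);
  lb_vertex : forall t, ~ lattice_point (alpha t);
  lb_law : forall t, exists u v,
    arrives alpha t u /\ departs alpha t v /\ v <> (0, 0) /\
    ((forall k, ~ isZ (height k (alpha t))) -> v = u) /\
    (forall k, isZ (height k (alpha t)) -> v = lact (Lmir k) u)
}.

Lemma billiard_departs alpha t :
  lattice_billiard alpha -> exists v, departs alpha t v.
Proof. intros [_ _ H]. destruct (H t) as (u & v & _ & Hv & _). now exists v. Qed.

Lemma departs_nonzero alpha t v :
  lattice_billiard alpha -> departs alpha t v -> v <> (0, 0).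
Proof.
  intros B Hv. destruct (lb_law _ B t) as (u & v' & _ & Hv' & H & _).
  now rewrite (departs_unique _ _ _ _ Hv Hv').
Qed.

Definition line (X v : point) (t : R) : point := add X (scale t v).

(** The element w carries position and departing velocity at time t to those of the
    line that starts at X with velocity V at time t0. *)
Definition unfolded_by (alpha : R -> point) (w : weyl) (X V : point) (t0 t : R) : Prop :=
  wact w (alpha t) = line X V (t - t0) /\
  forall v, departs alpha t v -> lact (lin w) v = V.

(** Away from strikes the same w serves before and after t. At a strike, w serves
    after t if and only if w composed with the reflection in the side struck serves
    before. So the set of times that can be unfolded is open with open complement. *)
Lemma unfolding_global alpha X V t0 a b :
  lattice_billiard alpha ->
  (exists w, unfolded_by alpha w X V t0 a) -> exists w, unfolded_by alpha w X V t0 b.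
Proof.
  intro B.
  apply (locally_constant_forall (fun t => exists w, unfolded_by alpha w X V t0 t)).
  clear a b. intro t.
  destruct (lb_law _ B t) as (u & v & Hu & Hv & _ & Hin & Hon).
  destruct (departs_persists _ _ _ Hv) as (e1 & He1 & Hright).
  destruct (arrives_before _ _ _ Hu) as (e2 & He2 & Hleft).
  exists (Rmin e1 e2). split; [apply Rmin_glb_lt; assumption|]. intros s Hs.
  pose proof (Rmin_l e1 e2). pose proof (Rmin_r e1 e2).
  apply Rabs_def2 in Hs.
  destruct (Rle_lt_dec t s) as [Hts|Hts].
  - (* the same element unfolds at times shortly after [t] *)
    destruct (Hright (s - t)) as [Hs1 Hs2]; [lra|].
    replace (t + (s - t)) with s in * by ring.
    assert (E : forall w, unfolded_by alpha w X V t0 s <-> unfolded_by alpha w X V t0 t).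
    { intro w. unfold unfolded_by. rewrite Hs1, wact_move. split; intros [H1 H2].
      - specialize (H2 v Hs2). split.
        + rewrite H2 in H1. unfold line in *.
          assert (E : wact w (alpha t) = sub (add X (scale (s - t0) V)) (scale (s - t) V)).
          { rewrite <- H1. generalize (wact w (alpha t)). intro. point_ring. }
          rewrite E. point_ring.
        + intros v' Hv'. now rewrite (departs_unique _ _ _ _ Hv' Hv).
      - specialize (H2 v Hv). split.
        + rewrite H1, H2. unfold line. point_ring.
        + intros v' Hv'. now rewrite (departs_unique _ _ _ _ Hv' Hs2). }
    split; intros [w Hw]; exists w; now apply E.
  - destruct (Hleft (t - s)) as [Hs1 Hs2]; [lra|].
    replace (t - (t - s)) with s in * by ring.
    assert (E : forall w w', wact w' (alpha t) = wact w (alpha t) ->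
       lact (lin w') u = lact (lin w) v ->
       (unfolded_by alpha w' X V t0 s <-> unfolded_by alpha w X V t0 t)).
    { intros w w' Ew El. unfold unfolded_by. rewrite Hs1.
      replace (sub (alpha t) (scale (t - s) u)) with (add (alpha t) (scale (s - t) u))
        by (generalize (alpha t); intro; point_ring).
      rewrite wact_move, Ew, El. split; intros [H1 H2].
      - specialize (H2 u Hs2). rewrite El in H2. split.
        + rewrite H2 in H1. unfold line in *.
          assert (E : wact w (alpha t) = sub (add X (scale (s - t0) V)) (scale (s - t) V)).
          { rewrite <- H1. generalize (wact w (alpha t)). intro. point_ring. }
          rewrite E. point_ring.
        + intros v' Hv'. now rewrite (departs_unique _ _ _ _ Hv' Hv).
      - specialize (H2 v Hv). split.
        + rewrite H1, H2. unfold line. point_ring.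
        + intros v' Hv'. rewrite (departs_unique _ _ _ _ Hv' Hs2). now rewrite El. }
    destruct (classic (exists k, isZ (height k (alpha t)))) as [[k Hk]|Hk].
    + (* a strike: [w] serves after [t] when [w'], which crosses the side, serves before *)
      specialize (Hon k Hk). destruct Hk as [n Hn].
      assert (Em : forall w, exists w', wact w' (alpha t) = wact w (alpha t) /\
        (forall x, lact (lin w') x = lact (lin w) (lact (Lmir k) x))).
      { intro w. destruct (wact_compose w (mirror_in k n)) as (w' & H1 & H2).
        exists w'. split.
        - rewrite H1, mirror_in_fixes by exact Hn. reflexivity.
        - intro x. now rewrite H2, lin_mirror_in. }
      split; intros [w Hw]; destruct (Em w) as (w' & H1 & H2); exists w'.
      * apply (proj1 (E w' w (eq_sym H1)
          ltac:(rewrite H2, Hon, mirror_involutive; reflexivity))). exact Hw.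
      * apply (proj2 (E w w' H1 ltac:(rewrite H2, Hon; reflexivity))). exact Hw.
    + assert (v = u) by (apply Hin; intros k Hk'; apply Hk; now exists k). subst v.
      split; intros [w Hw]; exists w; now apply (E w w eq_refl eq_refl).
Qed.

Lemma unfolding_line alpha t0 V t :
  lattice_billiard alpha -> departs alpha t0 V ->
  exists w, unfolded_by alpha w (alpha t0) V t0 t.
Proof.
  intros B HV. apply (unfolding_global alpha _ _ _ t0); [exact B|].
  exists (Weyl Lid 0 0). split.
  - unfold line. generalize (alpha t0). intro. point_ring.
  - intros v Hv. rewrite (departs_unique _ _ _ _ Hv HV). destruct V; reflexivity.
Qed.

Lemma height_line k X V t : height k (line X V t) = height k X + t * height k V.
Proof. destruct k, X, V; unfold line; point_ring. Qed.

(** W permutes the mirrors and the integer points, so whether a time is a strike can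
    be read off the line. *)
Lemma strike_on_line alpha t0 V t :
  lattice_billiard alpha -> departs alpha t0 V ->
  ((exists k, isZ (height k (alpha t))) <->
   (exists k, isZ (height k (line (alpha t0) V (t - t0))))) /\
  ~ lattice_point (line (alpha t0) V (t - t0)).
Proof.
  intros B HV. destruct (unfolding_line alpha t0 V t B HV) as (w & Hw & _).
  rewrite <- Hw. split.
  - split; intros [k Hk].
    + destruct (lfam_surj (lin w) k) as [k' <-]. exists k'. now apply isZ_height_wact.
    + exists (lfam (lin w) k). now apply isZ_height_wact.
  - rewrite lattice_point_wact. apply (lb_vertex _ B).
Qed.

(** Continuous induction from a: the velocity changes only at strikes, and the
    arriving velocity at the end of an interval is seen just before it. *)
Lemma free_flight alpha a b v :
  lattice_billiard alpha -> a < b -> departs alpha a v ->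
  (forall t, a < t < b -> forall k, ~ isZ (height k (alpha t))) ->
  (forall t, a <= t <= b -> alpha t = line (alpha a) v (t - a)) /\ arrives alpha b v.
Proof.
  intros B Hab Ha Hfree.
  set (Q := fun t => alpha t = line (alpha a) v (t - a) /\
                     (t < b -> departs alpha t v)).
  assert (HL : forall t, a < t <= b -> (forall s, a <= s < t -> Q s) ->
     alpha t = line (alpha a) v (t - a) /\ arrives alpha t v).
  { intros t Ht HQ. destruct (lb_law _ B t) as (u & v' & Hu & _).
    assert (Huv : u = v /\ alpha t = line (alpha a) v (t - a)).
    { destruct Hu as (e & He & Hu).
      set (h := Rmin e (t - a) / 2).
      assert (Hh : 0 < h < e /\ h < t - a).
      { unfold h, Rmin. destruct (Rle_dec e (t - a)); lra. }
      pose proof (Hu h ltac:(lra)) as H1.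
      pose proof (Hu (h / 2) ltac:(lra)) as H2.
      destruct (HQ (t - h) ltac:(lra)) as [H3 _].
      destruct (HQ (t - h / 2) ltac:(lra)) as [H4 _].
      rewrite H1 in H3. rewrite H2 in H4. clear H1 H2 HQ Hu Ha Hfree Q.
      unfold line in *. destruct (alpha t) as [x y], (alpha a) as [x0 y0].
      destruct u as [u1 u2], v as [v1 v2].
      unfold add, sub, scale in *; cbn [fst snd] in *.
      injection H3 as E1 E2. injection H4 as E3 E4.
      assert (u1 = v1) by (apply (Rmult_eq_reg_l (h / 2)); lra).
      assert (u2 = v2) by (apply (Rmult_eq_reg_l (h / 2)); lra).
      subst u1 u2. split; [reflexivity|].
      apply injective_projections; cbn [fst snd]; lra. }
    destruct Huv as [-> E]. now split. }
  assert (HQ : forall t, a <= t <= b -> Q t).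
  { apply real_induction.
    - split; [|now intros]. unfold line. generalize (alpha a). intro. point_ring.
    - intros t Ht [H1 H2]. specialize (H2 (proj2 Ht)).
      destruct (departs_persists _ _ _ H2) as (e & He & H). exists e.
      split; [exact He|]. intros s Hs _. destruct (H (s - t)) as [H3 H4]; [lra|].
      replace (t + (s - t)) with s in * by ring. split; [|now intros].
      rewrite H3, H1. unfold line. generalize (alpha a). intro. point_ring.
    - intros t Ht Hall. destruct (HL t Ht Hall) as [H1 H2]. split; [exact H1|].
      intro Htb. destruct (lb_law _ B t) as (u & v' & Hu & Hv' & _ & Hin & _).
      rewrite (arrives_unique _ _ _ _ H2 Hu).
      rewrite <- Hin; [exact Hv'|]. apply Hfree. lra. }
  split; [intros t Ht; now apply HQ|]. apply HL; [lra|].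
  intros s Hs. apply HQ. lra.
Qed.

Lemma unfolded_flight alpha w X V t0 a b t :
  lattice_billiard alpha -> unfolded_by alpha w X V t0 a -> a < b ->
  (forall t, a < t < b -> forall k, ~ isZ (height k (alpha t))) ->
  a <= t <= b -> wact w (alpha t) = line X V (t - t0).
Proof.
  intros B [H1 H2] Hab Hfree Ht.
  destruct (billiard_departs alpha a B) as [v Hv].
  destruct (free_flight alpha a b v B Hab Hv Hfree) as [Hl _].
  rewrite (Hl t Ht). specialize (H2 v Hv). unfold line in *.
  rewrite wact_move, H1, H2. point_ring.
Qed.

(** The reflection in a mirror that contains the unfolded point continues the
    unfolding across the strike: as the trajectory avoids vertices, that mirror is
    the image under w of the side struck. *)
Lemma unfolded_next alpha w X V t0 a b k n w' :
  lattice_billiard alpha -> unfolded_by alpha w X V t0 a -> a < b ->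
  (forall t, a < t < b -> forall k, ~ isZ (height k (alpha t))) ->
  height k (line X V (b - t0)) = IZR n ->
  (forall x, wact w' x = wact (mirror_in k n) (wact w x)) ->
  (forall x, lact (lin w') x = lact (Lmir k) (lact (lin w) x)) ->
  unfolded_by alpha w' X V t0 b.
Proof.
  intros B Hw Hab Hfree Hk H1 H2.
  pose proof (unfolded_flight _ _ _ _ _ a b b B Hw Hab Hfree ltac:(lra)) as Hb.
  split.
  - rewrite H1, Hb. now apply mirror_in_fixes.
  - intros v' Hv'.
    destruct (billiard_departs alpha a B) as [v Hv].
    destruct (free_flight alpha a b v B Hab Hv Hfree) as [_ Harr].
    destruct (lb_law _ B b) as (u & v'' & Hu & Hv'' & _ & _ & Hon).
    rewrite (departs_unique _ _ _ _ Hv' Hv'').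
    rewrite <- (arrives_unique _ _ _ _ Harr Hu) in Hon.
    rewrite (Hon (lfam (lin w) k)).
    + rewrite H2, <- mirror_conj, mirror_involutive. now apply Hw.
    + apply isZ_height_wact. rewrite Hb, Hk. now exists n.
Qed.

(** * Directions *)

(** Equality up to the 12 symmetries generated by the linear parts and -1: the
    linear parts of the reflections, of the symmetries of the tile (see [tile_sym]),
    and of the reversal of time. *)
Definition congruent_vel (v v' : point) : Prop :=
  exists l e, (e = 1 \/ e = -1) /\ v' = scale e (lact l v).

Lemma congruent_vel_sym v v' : congruent_vel v v' -> congruent_vel v' v.
Proof.
  intros (l & e & He & ->). destruct (lact_inverse l) as [l' Hl].
  exists l', e. split; [exact He|]. rewrite lact_scale, Hl.
  destruct v, He as [-> | ->]; point_ring.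
Qed.

Lemma congruent_vel_trans v v' v'' :
  congruent_vel v v' -> congruent_vel v' v'' -> congruent_vel v v''.
Proof.
  intros (l & e & He & ->) (l' & e' & He' & ->).
  destruct (lact_compose l' l) as [l'' Hl].
  exists l'', (e' * e). split.
  - destruct He as [-> | ->], He' as [-> | ->]; [left|right|right|left]; lra.
  - rewrite Hl, lact_scale. generalize (lact l' (lact l v)). intro. point_ring.
Qed.

(** The directions between 30 degrees (both coordinates equal) and 60 degrees (first
    coordinate zero) with the base. *)
Definition in_sector (v : point) : Prop := 0 <= fst v <= snd v /\ 0 < snd v.

(** The sector is a fundamental domain of the dihedral group of order 12, boundary
    directions included. *)
Lemma sector_unique v v' :
  in_sector v -> in_sector v' -> congruent_vel v v' -> v = v'.
Proof.
  intros H H' (l & e & He & E). revert H'. rewrite E. destruct v as [p q].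
  unfold in_sector, scale in *.
  destruct He as [-> | ->], l as [| | |[]]; cbn [lact fst snd] in *; intro H';
  apply injective_projections; cbn [fst snd]; lra.
Qed.

Lemma sector_exists v : v <> (0, 0) ->
  exists l e, (e = 1 \/ e = -1) /\ in_sector (scale e (lact l v)).
Proof.
  destruct v as [p q]. intro Hv.
  assert (Hpq : (p < 0 \/ 0 < p) \/ (q < 0 \/ 0 < q)).
  { destruct (Rtotal_order p 0) as [H|[H|H]]; [auto| |auto].
    destruct (Rtotal_order q 0) as [H'|[H'|H']]; [auto| |auto].
    exfalso. apply Hv. now subst. }
  unfold in_sector, scale.
  destruct (Rle_lt_dec 0 p), (Rle_lt_dec 0 q), (Rle_lt_dec 0 (p + q)),
    (Rle_lt_dec p q), (Rle_lt_dec 0 (p + 2 * q)), (Rle_lt_dec 0 (2 * p + q));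
  try (exfalso; lra);
  first
  [ exists Lid, 1; cbn [lact fst snd]; split; [now left|lra]
  | exists Lid, (-1); cbn [lact fst snd]; split; [now right|lra]
  | exists Lrot, 1; cbn [lact fst snd]; split; [now left|lra]
  | exists Lrot, (-1); cbn [lact fst snd]; split; [now right|lra]
  | exists Lrot2, 1; cbn [lact fst snd]; split; [now left|lra]
  | exists Lrot2, (-1); cbn [lact fst snd]; split; [now right|lra]
  | exists (Lmir FBC), 1; cbn [lact fst snd]; split; [now left|lra]
  | exists (Lmir FBC), (-1); cbn [lact fst snd]; split; [now right|lra]
  | exists (Lmir FAB), 1; cbn [lact fst snd]; split; [now left|lra]
  | exists (Lmir FAB), (-1); cbn [lact fst snd]; split; [now right|lra]
  | exists (Lmir FCA), 1; cbn [lact fst snd]; split; [now left|lra]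
  | exists (Lmir FCA), (-1); cbn [lact fst snd]; split; [now right|lra] ].
Qed.

Lemma billiard_velocities_congruent alpha t t' v v' :
  lattice_billiard alpha -> departs alpha t v -> departs alpha t' v' ->
  congruent_vel v v'.
Proof.
  intros B Hv Hv'. apply congruent_vel_sym.
  destruct (unfolding_line alpha t v t' B Hv) as (w & _ & H).
  exists (lin w), 1. split; [now left|]. rewrite (H v' Hv').
  destruct v; point_ring.
Qed.

Lemma arrival_congruent beta t u v :
  lattice_billiard beta -> arrives beta t u -> departs beta t v -> congruent_vel v u.
Proof.
  intros B Hu Hv. destruct (lb_law _ B t) as (u' & v' & Hu' & Hv' & _ & Hin & Hon).
  rewrite (arrives_unique _ _ _ _ Hu Hu'), (departs_unique _ _ _ _ Hv Hv').
  destruct (classic (exists k, isZ (height k (beta t)))) as [[k Hk]|Hk].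
  - exists (Lmir k), 1. split; [now left|]. rewrite (Hon k Hk), mirror_involutive.
    destruct u'. point_ring.
  - exists Lid, 1. split; [now left|]. rewrite Hin; [destruct u'; point_ring|].
    intros k Hk'. apply Hk. now exists k.
Qed.

(** * Counting strikes *)

(** On a half-open window of length len an affine function of slope c takes
    len * c integer values, each once, wherever the window starts. A constant function
    takes none as soon as its value is not an integer. *)
Lemma count_integer_times x c len s N :
  0 <= c -> 0 < len -> len * c = INR N -> (c = 0 -> ~ isZ x) ->
  exists l, NoDup l /\ length l = N /\
    forall t, In t l <-> (s <= t < s + len /\ isZ (x + t * c)).
Proof.
  intros Hc Hlen HN Hx.
  destruct (Req_dec c 0) as [->|Hc0].
  - exists nil. assert (N = 0%nat) by (apply INR_eq; simpl; lra). subst N.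
    split; [constructor|]. split; [reflexivity|]. intro t. split; [now intros|intros [_ H]].
    exfalso. apply (Hx eq_refl). now rewrite Rmult_0_r, Rplus_0_r in H.
  - (* the least integer that is at least the value at the start of the window *)
    set (k0 := (- Int_part (- (x + s * c)))%Z).
    assert (Hk0 : x + s * c <= IZR k0 < x + s * c + 1).
    { unfold k0. rewrite opp_IZR. destruct (base_Int_part (- (x + s * c))). lra. }
    set (f := fun m : nat => (IZR k0 + INR m - x) / c).
    assert (Hf : forall m t, t = f m <-> x + t * c = IZR k0 + INR m).
    { intros m t. unfold f. split; intro H.
      - subst t. field. lra.
      - apply (Rmult_eq_reg_r c); [|lra]. field_simplify; lra. }
    exists (map f (seq 0 N)). split; [|split].
    + apply Injective_map_NoDup; [|apply seq_NoDup]. intros m m' E.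
      apply INR_eq. pose proof (proj1 (Hf m (f m)) eq_refl).
      pose proof (proj1 (Hf m' (f m)) E). lra.
    + now rewrite length_map, length_seq.
    + intro t. rewrite in_map_iff. split.
      * intros (m & Hm & Hin). symmetry in Hm. apply Hf in Hm.
        apply in_seq in Hin.
        assert (0 <= INR m <= INR N - 1).
        { split; [apply pos_INR|]. assert (H1 : (S m <= N)%nat) by lia.
          apply le_INR in H1. rewrite S_INR in H1. lra. }
        split; [|exists (k0 + Z.of_nat m)%Z; rewrite plus_IZR, <- INR_IZR_INZ; exact Hm].
        split; [apply (Rmult_le_reg_r c)|apply (Rmult_lt_reg_r c)]; lra.
      * intros [Ht [z Hz]].
        assert (Hz1 : (k0 <= z)%Z).
        { apply Znot_gt_le. intro. assert (z + 1 <= k0)%Z as H1 by lia.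
          apply IZR_le in H1. rewrite plus_IZR in H1. nra. }
        assert (Hz2 : (z < k0 + Z.of_nat N)%Z).
        { apply Znot_ge_lt. intro H1. apply Z.ge_le, IZR_le in H1.
          rewrite plus_IZR, <- INR_IZR_INZ in H1. nra. }
        exists (Z.to_nat (z - k0)). split.
        -- symmetry. apply Hf. rewrite Hz, INR_IZR_INZ, Z2Nat.id by lia.
           rewrite minus_IZR. ring.
        -- apply in_seq. lia.
Qed.

Definition strikes (X V : point) (t0 t : R) : Prop :=
  exists k, isZ (height k (line X V (t - t0))).

(** The vector (a, c) crosses a + c mirrors of direction FCA besides the c and a of
    the other two, and no two crossings coincide as the line avoids integer points. A
    line parallel to a direction of mirrors does not lie in one of them, since it would
    then run into an integer point. *)
Lemma count_strikes X V t0 len s a c :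
  in_sector V -> 0 < len -> (forall t, ~ lattice_point (line X V (t - t0))) ->
  scale len V = (INR a, INR c) ->
  exists l, NoDup l /\ length l = (2 * (a + c))%nat /\
    forall t, In t l <-> (s <= t < s + len /\ strikes X V t0 t).
Proof.
  intros HV Hlen Hfree HLV.
  assert (Hh : forall k t, height k (line X V (t - t0)) =
     (height k X - t0 * height k V) + t * height k V).
  { intros. rewrite height_line. ring. }
  set (N := fun k => match k with FBC => c | FAB => a | FCA => (a + c)%nat end).
  assert (HN : forall k, len * height k V = INR (N k)).
  { destruct V as [p q]. unfold scale in HLV. cbn [fst snd] in HLV.
    injection HLV as H1 H2.
    intros []; cbn [height fst snd N]; [lra|lra|rewrite plus_INR; lra]. }
  assert (HP : forall k, 0 <= height k V).
  { destruct HV as [H1 H2]. intros []; cbn [height]; lra. }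
  assert (HZ : forall k, height k V = 0 -> ~ isZ (height k X - t0 * height k V)).
  { intros k Hk HZ. set (t := (- snd X) / snd V). destruct HV as [H1 H2].
    apply (Hfree (t0 + t)). replace (t0 + t - t0) with t by ring.
    apply (two_families_lattice k FBC).
    - intros ->. cbn [height] in Hk. lra.
    - rewrite height_line, Hk. rewrite Hk in HZ.
      replace (height k X + t * 0) with (height k X - t0 * 0) by ring. exact HZ.
    - rewrite height_line. exists 0%Z. cbn [height]. unfold t. field. lra. }
  assert (Hl : forall k, exists l, NoDup l /\ length l = N k /\
    forall t, In t l <-> (s <= t < s + len /\ isZ (height k (line X V (t - t0))))).
  { intro k. destruct (count_integer_times _ _ len s (N k) (HP k) Hlen (HN k) (HZ k))
      as (l & H1 & H2 & H3). exists l. split; [exact H1|]. split; [exact H2|].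
    intro t. rewrite H3, Hh. reflexivity. }
  destruct (Hl FBC) as (l1 & N1 & L1 & I1).
  destruct (Hl FAB) as (l2 & N2 & L2 & I2).
  destruct (Hl FCA) as (l3 & N3 & L3 & I3).
  assert (Hdisj : forall k k' t, k <> k' -> isZ (height k (line X V (t - t0))) ->
     isZ (height k' (line X V (t - t0))) -> False).
  { intros k k' t Hkk H1 H2. apply (Hfree t). now apply (two_families_lattice k k'). }
  exists (l1 ++ l2 ++ l3). split; [|split].
  - apply NoDup_app; [exact N1| |].
    + apply NoDup_app; [exact N2|exact N3|].
      intros t H2 H3. apply I2 in H2. apply I3 in H3.
      apply (Hdisj FAB FCA t); [discriminate|apply H2|apply H3].
    + intros t H1 H2. apply I1 in H1. apply in_app_iff in H2 as [H2|H2].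
      * apply I2 in H2. apply (Hdisj FBC FAB t); [discriminate|apply H1|apply H2].
      * apply I3 in H2. apply (Hdisj FBC FCA t); [discriminate|apply H1|apply H2].
  - rewrite !length_app, L1, L2, L3. cbn [N]. lia.
  - intro t. rewrite !in_app_iff, I1, I2, I3. unfold strikes. split.
    + intros [[H1 H2]|[[H1 H2]|[H1 H2]]]; split; eauto.
    + intros [H1 [[] H2]]; tauto.
Qed.

(** The line is parallel to a side direction, halfway between two mirrors of that
    direction. It meets the other two kinds of mirror alternately, each time that twice
    its second coordinate is an integer, hence an odd number of times when it advances
    by half an odd number. *)
Lemma count_glide_strikes x q t0 len s a b :
  0 < q -> 0 < len -> 2 * x = IZR (2 * a + 1) -> len * (2 * q) = IZR (2 * b + 1) ->
  exists l N, NoDup l /\ length l = (2 * N + 1)%nat /\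
    forall t, In t l <-> (s <= t < s + len /\ strikes (x, 0) (0, q) t0 t).
Proof.
  intros Hq Hlen Hx HL.
  assert (Hb : (0 <= b)%Z).
  { assert (0 < 2 * b + 1)%Z; [|lia]. apply lt_IZR. rewrite <- HL. nra. }
  destruct (count_integer_times (- t0 * (2 * q)) (2 * q) len s (2 * Z.to_nat b + 1))
    as (l & H1 & H2 & H3); [lra|exact Hlen| |lra|].
  { rewrite HL, INR_IZR_INZ. f_equal. lia. }
  exists l, (Z.to_nat b). split; [exact H1|]. split; [exact H2|].
  intro t. rewrite H3.
  replace (- t0 * (2 * q) + t * (2 * q)) with (2 * ((t - t0) * q)) by ring.
  set (y := (t - t0) * q).
  assert (E : isZ (2 * y) <-> strikes (x, 0) (0, q) t0 t); [|now rewrite E].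
  unfold strikes, line, add, scale. rewrite plus_IZR, mult_IZR in Hx. split.
  - intros [z Hz]. destruct (Z.Even_or_Odd z) as [[m Hm]|[m Hm]]; subst z.
    + exists FBC, m. cbn [height fst snd]. fold y. rewrite mult_IZR in Hz. lra.
    + exists FCA, (a + m + 1)%Z. cbn [height fst snd]. fold y.
      rewrite plus_IZR, mult_IZR in Hz. rewrite !plus_IZR. lra.
  - intros [[] [z Hz]]; cbn [height fst snd] in Hz; try fold y in Hz.
    + exists (2 * z)%Z. rewrite mult_IZR. lra.
    + exfalso. assert (E : IZR (2 * a + 1) = IZR (2 * z)).
      { rewrite plus_IZR, !mult_IZR. lra. }
      apply eq_IZR in E. lia.
    + exists (2 * z - (2 * a + 1))%Z. rewrite minus_IZR, plus_IZR, !mult_IZR. lra.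
Qed.

Lemma NoDup_same_length (l l' : list R) :
  NoDup l -> NoDup l' -> (forall t, In t l <-> In t l') -> length l = length l'.
Proof. intros. now apply Permutation_length, NoDup_Permutation. Qed.

(** The element w that unfolds the trajectory after one period fixes V. Only the
    identity and, for the direction of 60 degrees, one reflection fix a direction of the
    sector. The reflection would make w a glide reflection and the number of strikes
    odd. *)
Lemma period_vector alpha t0 V len s l n :
  lattice_billiard alpha -> departs alpha t0 V -> in_sector V ->
  snd (alpha t0) = 0 -> 0 < len ->
  alpha (t0 + len) = alpha t0 -> departs alpha (t0 + len) V ->
  NoDup l -> length l = (2 * n)%nat ->
  (forall t, In t l <-> (s <= t < s + len /\ exists k, isZ (height k (alpha t)))) ->
  exists a b, (2 * a + 3 * b = n)%nat /\ scale len V = (INR a, INR (a + 3 * b)).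
Proof.
  intros B HV HS Hbase Hlen Hret HVret ND Hn Hl.
  assert (Hfree : forall t, ~ lattice_point (line (alpha t0) V (t - t0))).
  { intro t. apply (strike_on_line alpha t0 V t B HV). }
  assert (Hl' : forall t, In t l <-> (s <= t < s + len /\ strikes (alpha t0) V t0 t)).
  { intro t. rewrite Hl. unfold strikes.
    now rewrite (proj1 (strike_on_line alpha t0 V t B HV)). }
  destruct (unfolding_line alpha t0 V (t0 + len) B HV) as (w & Hw1 & Hw2).
  specialize (Hw2 V HVret). rewrite Hret in Hw1.
  replace (t0 + len - t0) with len in Hw1 by ring.
  pose proof (lb_vertex _ B t0) as Hv0.
  destruct w as [wl wb wk]. unfold wact, line in Hw1. cbn [lin tb tk] in Hw1, Hw2.
  destruct (alpha t0) as [x y]. cbn [fst snd] in Hbase. subst y.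
  destruct V as [p q]. destruct HS as [HS1 HS2]. cbn [fst snd] in HS1, HS2.
  unfold add, scale in *.
  destruct wl as [| | |[]]; cbn [lact fst snd] in *;
    pose proof (f_equal fst Hw1) as E1; pose proof (f_equal snd Hw1) as E2;
    pose proof (f_equal fst Hw2) as E3;
    pose proof (f_equal snd Hw2) as E4; clear Hw1 Hw2; cbn [fst snd] in E1, E2, E3, E4;
    try (exfalso; lra).
  - (* translation *)
    assert (Hpq : len * p <= len * q) by (apply Rmult_le_compat_l; lra).
    assert (Hp0 : 0 <= len * p) by (apply Rmult_le_pos; lra).
    assert (Hb : (0 <= wb)%Z) by (apply le_IZR; lra).
    assert (Hbk : (0 <= wb + 3 * wk)%Z) by (apply le_IZR; lra).
    assert (Hk : (wk <= 0)%Z).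
    { assert (wb + 3 * wk <= wb)%Z; [|lia]. apply le_IZR. lra. }
    exists (Z.to_nat (wb + 3 * wk)), (Z.to_nat (- wk)).
    assert (Ev : (len * p, len * q) = (INR (Z.to_nat (wb + 3 * wk)),
       INR (Z.to_nat (wb + 3 * wk) + 3 * Z.to_nat (- wk)))).
    { rewrite !INR_IZR_INZ.
      replace (Z.of_nat (Z.to_nat (wb + 3 * wk) + 3 * Z.to_nat (- wk))) with wb by lia.
      rewrite Z2Nat.id by lia. f_equal; lra. }
    split; [|exact Ev].
    destruct (count_strikes (x, 0) (p, q) t0 len s (Z.to_nat (wb + 3 * wk))
       (Z.to_nat (wb + 3 * wk) + 3 * Z.to_nat (- wk)))
      as (l' & N1 & N2 & N3); [split; cbn [fst snd]; lra|exact Hlen|exact Hfree|exact Ev|].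
    assert (length l = length l').
    { apply NoDup_same_length; trivial. intro t. now rewrite Hl', N3. }
    lia.
  - (* glide reflection along a side direction *)
    exfalso. assert (p = 0) by lra. subst p.
    assert (Hx2 : 2 * x = IZR (wb + 3 * wk)) by lra.
    destruct (Z.Even_or_Odd (wb + 3 * wk)) as [[m Hm]|[m Hm]]; rewrite Hm in Hx2.
    { apply Hv0. split; [exists m|exists 0%Z]; cbn [fst snd]; [|reflexivity].
      rewrite mult_IZR in Hx2. lra. }
    assert (Hq2 : len * (2 * q) = IZR (2 * (wb + m) + 1)).
    { rewrite plus_IZR, !mult_IZR, plus_IZR in *. lra. }
    destruct (count_glide_strikes x q t0 len s m (wb + m) HS2 Hlen Hx2 Hq2)
      as (l' & N & N1 & N2 & N3).
    assert (length l = length l').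
    { apply NoDup_same_length; trivial. intro t. now rewrite Hl', N3. }
    lia.
Qed.

(** * Folding a line into the tile *)

(** The barycentric coordinates, which vanish on the three sides. *)
Definition gap (k : mirror_family) (X : point) : R :=
  match k with FBC => snd X | FAB => fst X | FCA => 1 - fst X - snd X end.

(** The linear part of [gap]. *)
Definition dgap (k : mirror_family) (u : point) : R :=
  match k with FBC => snd u | FAB => fst u | FCA => - fst u - snd u end.

Lemma in_tile_gap X : in_tile X <-> forall k, 0 <= gap k X.
Proof.
  unfold in_tile. split.
  - intros H []; cbn [gap]; lra.
  - intro H. pose proof (H FBC). pose proof (H FAB). pose proof (H FCA).
    cbn [gap] in *. lra.
Qed.

Lemma gap_move k X h u : gap k (add X (scale h u)) = gap k X + h * dgap k u.
Proof. destruct X, u, k; unfold add, scale; cbn [gap dgap fst snd]; ring. Qed.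

Lemma gap_lattice X k : in_tile X -> ~ lattice_point X ->
  (isZ (height k X) <-> gap k X = 0).
Proof.
  intros HX Hv. destruct X as [i j]. unfold in_tile in HX. cbn [fst snd] in HX.
  assert (H01 : forall n, 0 <= IZR n <= 1 -> IZR n = 0 \/ IZR n = 1).
  { intros n [H0 H1]. apply le_IZR in H0, H1.
    assert (n = 0 \/ n = 1)%Z as [-> | ->] by lia; auto. }
  assert (Hc : forall n m, i = IZR n -> j = IZR m -> False).
  { intros n m -> ->. apply Hv. split; [exists n|exists m]; reflexivity. }
  destruct k; cbn [height gap fst snd]; split; intro H.
  - destruct H as [n Hn]. destruct (H01 n) as [H|H]; [lra|lra|].
    exfalso. apply (Hc 0%Z 1%Z); lra.
  - now exists 0%Z.
  - destruct H as [n Hn]. destruct (H01 n) as [H|H]; [lra|lra|].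
    exfalso. apply (Hc 1%Z 0%Z); lra.
  - now exists 0%Z.
  - destruct H as [n Hn]. destruct (H01 n) as [H|H]; [lra| |lra].
    exfalso. apply (Hc 0%Z 0%Z); lra.
  - exists 1%Z. lra.
Qed.

Lemma dgap_height k u : dgap k u = 0 <-> height k u = 0.
Proof. destruct k; cbn [dgap height]; lra. Qed.

Lemma dgap_mirror k u : dgap k (lact (Lmir k) u) = - dgap k u.
Proof. destruct k, u; cbn [dgap lact fst snd]; ring. Qed.

(** Otherwise the trajectory would leave the tile. *)
Lemma departs_inward beta t v k :
  lattice_billiard beta -> departs beta t v -> gap k (beta t) = 0 -> 0 <= dgap k v.
Proof.
  intros B (e & He & H) Hk. specialize (H (e / 2) ltac:(lra)).
  pose proof (proj1 (in_tile_gap _) (lb_tile _ B (t + e / 2)) k) as Hg.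
  rewrite H, gap_move, Hk in Hg.
  apply (Rmult_le_reg_l (e / 2)); lra.
Qed.

(** Modulo the translations in W, the colouring leaves three unit rhombi, each cut
    into two triangles: each of these six triangles is carried to the tile by an
    explicit element. *)
Lemma fold_exists X : exists w, in_tile (wact w X).
Proof.
  destruct X as [i j].
  destruct (base_Int_part i) as [Hi1 Hi2]. destruct (base_Int_part j) as [Hj1 Hj2].
  set (m := Int_part i) in *. set (n := Int_part j) in *. clearbody m n.
  assert (Hw : exists w0, in_tile (wact w0 (i - IZR n - 3 * IZR ((m - n) / 3), j - IZR n))).
  { set (z := ((m - n) / 3)%Z) in *.
    assert (Hz : IZR m - IZR n = 3 * IZR z \/ IZR m - IZR n = 3 * IZR z + 1 \/
                 IZR m - IZR n = 3 * IZR z + 2).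
    { pose proof (Z.div_mod (m - n) 3 ltac:(lia)) as E1.
      pose proof (Z.mod_pos_bound (m - n) 3 ltac:(lia)) as E2. fold z in E1.
      rewrite <- minus_IZR, <- mult_IZR, <- !plus_IZR.
      assert (m - n = 3 * z \/ m - n = 3 * z + 1 \/ m - n = 3 * z + 2)%Z as [E|[E|E]] by lia;
      rewrite E; auto. }
    (* lower or upper triangle of the rhombus, then the colour of its lower left corner *)
    destruct (Rle_lt_dec (i - IZR m + (j - IZR n)) 1);
    destruct Hz as [Hz|[Hz|Hz]].
    - exists (Weyl Lid 0 0). unfold wact, in_tile, add; cbn [lin tb tk lact fst snd].
      change (0 + 3 * 0)%Z with 0%Z. lra.
    - exists (Weyl Lrot2 (-1) 1). unfold wact, in_tile, add; cbn [lin tb tk lact fst snd].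
      change (-1 + 3 * 1)%Z with 2%Z. lra.
    - exists (Weyl Lrot 3 (-1)). unfold wact, in_tile, add; cbn [lin tb tk lact fst snd].
      change (3 + 3 * -1)%Z with 0%Z. lra.
    - exists (Weyl (Lmir FCA) 1 0). unfold wact, in_tile, add; cbn [lin tb tk lact fst snd].
      change (1 + 3 * 0)%Z with 1%Z. lra.
    - exists (Weyl (Lmir FBC) 1 (-1)). unfold wact, in_tile, add; cbn [lin tb tk lact fst snd].
      change (1 + 3 * -1)%Z with (-2)%Z. lra.
    - exists (Weyl (Lmir FAB) (-3) 2). unfold wact, in_tile, add; cbn [lin tb tk lact fst snd].
      change (-3 + 3 * 2)%Z with 3%Z. lra. }
  destruct Hw as [w0 Hw0].
  destruct (wact_compose w0 (Weyl Lid (- n) (- ((m - n) / 3)))) as (w & Hw & _).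
  exists w. rewrite Hw.
  replace (wact (Weyl Lid (- n) (- ((m - n) / 3))) (i, j))
    with (i - IZR n - 3 * IZR ((m - n) / 3), j - IZR n); [exact Hw0|].
  symmetry. point_ring.
Qed.

(** The tile is a fundamental domain. Two points of the tile differ by little, which
    leaves finitely many elements of W to examine; each either sends no point of the
    tile into the tile or fixes every point that it sends there. *)
Lemma fold_unique X w : in_tile X -> in_tile (wact w X) -> wact w X = X.
Proof.
  destruct X as [i j], w as [l b k].
  unfold in_tile, wact, add; cbn [lin tb tk fst snd].
  rewrite plus_IZR, mult_IZR. intros H1 H2.
  (* comparing the second coordinates, then the first ones, bounds both integers *)
  assert (Hb : (-2 < b < 3)%Z).
  { destruct l as [| | |[]]; cbn [lact fst snd] in *;
    split; apply lt_IZR; lra. }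
  assert (Hk : (-2 < k < 2)%Z).
  { destruct l as [| | |[]]; cbn [lact fst snd] in *;
    split; apply lt_IZR; lra. }
  assert (b = -1 \/ b = 0 \/ b = 1 \/ b = 2)%Z as [-> |[-> |[-> | ->]]] by lia;
  assert (k = -1 \/ k = 0 \/ k = 1)%Z as [-> |[-> | ->]] by lia;
  destruct l as [| | |[]]; cbn [lact fst snd] in *;
  first [exfalso; lra | apply injective_projections; cbn [fst snd]; lra].
Qed.

Lemma stays_in_tile X u :
  (forall k, 0 < gap k X \/ (gap k X = 0 /\ 0 <= dgap k u)) ->
  exists e, 0 < e /\ forall h, 0 <= h < e -> in_tile (add X (scale h u)).
Proof.
  intro H.
  assert (H1 : forall k, exists e, 0 < e /\
    forall h, 0 <= h < e -> 0 <= gap k (add X (scale h u))).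
  { intro k. destruct (H k) as [Hk|[Hk Hd]].
    - exists (gap k X / (Rabs (dgap k u) + 1)).
      pose proof (Rabs_pos (dgap k u)).
      split; [apply Rdiv_lt_0_compat; lra|]. intros h Hh. rewrite gap_move.
      assert (Hh' : h * (Rabs (dgap k u) + 1) < gap k X).
      { apply (Rmult_lt_reg_r (/ (Rabs (dgap k u) + 1))).
        - apply Rinv_0_lt_compat. lra.
        - rewrite Rmult_assoc, Rinv_r, Rmult_1_r by lra. apply Hh. }
      pose proof (Rle_abs (- dgap k u)) as Ha. rewrite Rabs_Ropp in Ha.
      assert (h * - dgap k u <= h * Rabs (dgap k u)) by (apply Rmult_le_compat_l; lra).
      lra.
    - exists 1. split; [lra|]. intros h Hh. rewrite gap_move, Hk.
      assert (0 <= h * dgap k u) by (apply Rmult_le_pos; lra). lra. }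
  destruct (H1 FBC) as (e1 & P1 & Q1). destruct (H1 FAB) as (e2 & P2 & Q2).
  destruct (H1 FCA) as (e3 & P3 & Q3).
  exists (Rmin e1 (Rmin e2 e3)).
  split; [repeat apply Rmin_glb_lt; assumption|].
  intros h Hh. pose proof (Rmin_l e1 (Rmin e2 e3)). pose proof (Rmin_r e1 (Rmin e2 e3)).
  pose proof (Rmin_l e2 e3). pose proof (Rmin_r e2 e3).
  apply in_tile_gap. intros []; [apply Q1|apply Q2|apply Q3]; lra.
Qed.

Definition fold_spec (X Y : point) : Prop := in_tile Y /\ exists w, Y = wact w X.

Lemma fold_point X : {Y | fold_spec X Y}.
Proof.
  apply constructive_indefinite_description.
  destruct (fold_exists X) as [w Hw]. exists (wact w X). split; [exact Hw|now exists w].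
Qed.

Definition fold (X : point) : point := proj1_sig (fold_point X).

Lemma fold_eq X w : in_tile (wact w X) -> fold X = wact w X.
Proof.
  intro H. unfold fold. destruct (fold_point X) as (Y & HY & w' & E). cbn [proj1_sig].
  destruct (wact_inverse w) as (wi & Hi & _).
  destruct (wact_compose w' wi) as (w'' & Hc & _).
  assert (E' : Y = wact w'' (wact w X)) by now rewrite Hc, Hi.
  rewrite E'. apply fold_unique; [exact H|]. now rewrite <- E'.
Qed.

Lemma wact_line w X V t h :
  wact w (line X V (t + h)) = add (wact w (line X V t)) (scale h (lact (lin w) V)).
Proof.
  rewrite <- wact_move. f_equal. unfold line. point_ring.
Qed.

(** Near a time t one element w folds the line at all times at which it keeps it in
    the tile. In the interior this covers both sides of t. On a side, which the line
    crosses transversally, w covers the future for one of the two elements that fold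
    the point at time t, and the other, which differs from it by the reflection in
    that side, covers the past. The second conclusion says that all velocities have
    the same norm. *)
Lemma folded_line_billiard X V :
  V <> (0, 0) ->
  (forall t, ~ lattice_point (line X V t)) ->
  (forall k t, isZ (height k (line X V t)) -> height k V <> 0) ->
  lattice_billiard (fun t => fold (line X V t)) /\
  (forall t, exists l, forall v, departs (fun t => fold (line X V t)) t v -> v = lact l V).
Proof.
  intros HV Hlat Htr.
  set (alpha := fun t => fold (line X V t)).
  assert (Hfold : forall t, in_tile (alpha t) /\ exists w, alpha t = wact w (line X V t)).
  { intro t. unfold alpha, fold. destruct (fold_point (line X V t)) as (Y & HY). exact HY. }
  assert (Hnl : forall t, ~ lattice_point (alpha t)).
  { intro t. destruct (Hfold t) as [_ [w ->]]. rewrite lattice_point_wact. apply Hlat. }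
  assert (Hmove : forall t w u e, alpha t = wact w (line X V t) ->
    (forall h, 0 <= h < e -> in_tile (add (alpha t) (scale h u))) ->
    (u = lact (lin w) V -> forall h, 0 <= h < e -> alpha (t + h) = add (alpha t) (scale h u)) /\
    (u = scale (-1) (lact (lin w) V) ->
       forall h, 0 <= h < e -> alpha (t - h) = sub (alpha t) (scale h (lact (lin w) V)))).
  { intros t w u e Hw Hin. split; intros -> h Hh.
    - rewrite Hw. rewrite <- wact_line. apply fold_eq. rewrite wact_line, <- Hw. now apply Hin.
    - replace (sub (alpha t) (scale h (lact (lin w) V)))
        with (wact w (line X V (t - h))).
      + apply fold_eq. unfold Rminus. rewrite wact_line, <- Hw.
        replace (scale (- h) (lact (lin w) V)) with (scale h (scale (-1) (lact (lin w) V)))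
          by (generalize (lact (lin w) V); intro; point_ring).
        now apply Hin.
      + unfold Rminus. rewrite wact_line, <- Hw. generalize (alpha t), (lact (lin w) V).
        intros. point_ring. }
  assert (Hinv : forall w, lact (lin w) V <> (0, 0)).
  { intros w E. apply HV. destruct (wact_inverse w) as (w' & _ & H).
    rewrite <- (H V), E. destruct (lin w') as [| | |[]]; cbn [lact]; f_equal; ring. }
  (* among the elements that fold the point at time [t], one makes the velocity point inward *)
  assert (Hpick : forall t, exists w, alpha t = wact w (line X V t) /\
    forall k, gap k (alpha t) = 0 -> 0 < dgap k (lact (lin w) V)).
  { intro t. destruct (Hfold t) as [Hin [w Hw]].
    destruct (classic (exists k, isZ (height k (alpha t)))) as [[k Hk]|Hk].
    - assert (Huniq : forall k', gap k' (alpha t) = 0 -> k' = k).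
      { intros k' Hk'. destruct (classic (k' = k)) as [E|E]; [exact E|]. exfalso.
        apply (Hnl t). apply (two_families_lattice k' k); trivial.
        apply gap_lattice; auto. }
      assert (Hne : dgap k (lact (lin w) V) <> 0).
      { rewrite dgap_height. rewrite Hw in Hk. apply isZ_height_wact, Htr in Hk.
        destruct (height_lact (lin w) k V) as [-> | ->]; lra. }
      destruct (Rlt_le_dec 0 (dgap k (lact (lin w) V))) as [Hp|Hn].
      + exists w. split; [exact Hw|]. intros k' Hk'. now rewrite (Huniq k' Hk').
      + destruct Hk as [n Hn']. destruct (wact_compose (mirror_in k n) w) as (w' & H1 & H2).
        exists w'. split.
        * rewrite H1, <- Hw, mirror_in_fixes by exact Hn'. reflexivity.
        * intros k' Hk'. rewrite (Huniq k' Hk'), H2, lin_mirror_in, dgap_mirror. lra.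
    - exists w. split; [exact Hw|]. intros k Hk'. exfalso. apply Hk. exists k.
      apply gap_lattice; auto. }
  assert (Hgap : forall t k, 0 <= gap k (alpha t)).
  { intros t. apply in_tile_gap, Hfold. }
  assert (Hdep : forall t w, alpha t = wact w (line X V t) ->
    (forall k, gap k (alpha t) = 0 -> 0 < dgap k (lact (lin w) V)) ->
    departs alpha t (lact (lin w) V)).
  { intros t w Hw Hin.
    destruct (stays_in_tile (alpha t) (lact (lin w) V)) as (e & He & Hs).
    { intro k. destruct (Hgap t k) as [Hk|Hk]; [now left|right].
      split; [now symmetry|]. apply Rlt_le, Hin. now symmetry. }
    exists e. split; [exact He|]. now apply (Hmove t w _ e Hw Hs). }
  split.
  - split; [apply Hfold|exact Hnl|]. intro t.
    destruct (Hpick t) as (w & Hw & Hin). set (v := lact (lin w) V).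
    destruct (classic (exists k, isZ (height k (alpha t)))) as [[k Hk]|Hk].
    + pose proof Hk as HkZ. destruct Hk as [n Hn].
      destruct (wact_compose (mirror_in k n) w) as (w' & H1 & H2).
      assert (Hw' : alpha t = wact w' (line X V t)).
      { rewrite H1, <- Hw, mirror_in_fixes by exact Hn. reflexivity. }
      assert (Hu : lact (lin w') V = lact (Lmir k) v) by now rewrite H2, lin_mirror_in.
      assert (Huniq : forall k', isZ (height k' (alpha t)) -> k' = k).
      { intros k' Hk'. destruct (classic (k' = k)) as [E|E]; [exact E|]. exfalso.
        apply (Hnl t). now apply (two_families_lattice k' k). }
      exists (lact (Lmir k) v), v. split; [|split; [|split; [|split]]].
      * destruct (stays_in_tile (alpha t) (scale (-1) (lact (lin w') V))) as (e & He & Hs).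
        { intro k'. destruct (Hgap t k') as [Hk'|Hk']; [now left|right].
          split; [now symmetry|].
          assert (k' = k) as -> by (apply Huniq; apply gap_lattice; [apply Hfold|apply Hnl|now symmetry]).
          pose proof (Hin k (eq_sym Hk')) as Hpos. fold v in Hpos.
          pose proof (dgap_mirror k v) as Hm. rewrite <- Hu in Hm.
          destruct (lact (lin w') V) as [p q], k; unfold scale; cbn [dgap fst snd] in *; lra. }
        exists e. split; [exact He|]. rewrite <- Hu. now apply (Hmove t w' _ e Hw' Hs).
      * now apply Hdep.
      * apply Hinv.
      * intro Hno. exfalso. now apply (Hno k).
      * intros k' Hk'. rewrite (Huniq k' Hk'). now rewrite mirror_involutive.
    + assert (Hpos : forall k, 0 < gap k (alpha t)).
      { intro k. destruct (Hgap t k) as [Hk'|Hk']; [exact Hk'|]. exfalso. apply Hk.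
        exists k. apply gap_lattice; [apply Hfold|apply Hnl|now symmetry]. }
      exists v, v. split; [|split; [|split; [|split]]].
      * destruct (stays_in_tile (alpha t) (scale (-1) v)) as (e & He & Hs).
        { intro k. left. apply Hpos. }
        exists e. split; [exact He|]. now apply (Hmove t w _ e Hw Hs).
      * now apply Hdep.
      * apply Hinv.
      * reflexivity.
      * intros k Hk'. exfalso. apply Hk. now exists k.
  - intro t. destruct (Hpick t) as (w & Hw & Hin). exists (lin w). intros v Hv.
    exact (departs_unique _ _ _ _ Hv (Hdep t w Hw Hin)).
Qed.

(** The line starts on the base at x = 1 / (2q), where q = a + 3b. If it met an
    integer point (n, m), then 1/2 + m a = n q would be an integer. Its vector after
    one unit of time is (a, a + 3b), a translation of W, so the folded line has
    period 1. *)
Lemma periodic_billiard_exists a b : (0 < a + 3 * b)%nat ->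
  exists alpha, lattice_billiard alpha /\
    (forall t, alpha (t + 1) = alpha t) /\ snd (alpha 0) = 0 /\
    departs alpha 0 (INR a, INR (a + 3 * b)) /\
    (forall t v, departs alpha t v ->
       exists l, v = lact l (INR a, INR (a + 3 * b))).
Proof.
  intro Hq. set (q := (a + 3 * b)%nat) in *. set (V := (INR a, INR q)).
  assert (Hq1 : 1 <= INR q) by (apply (le_INR 1); lia).
  assert (Ha : 0 <= INR a) by apply pos_INR.
  set (x := / (2 * INR q)).
  assert (Hx : x * (2 * INR q) = 1) by (unfold x; field; lra).
  assert (Hx0 : 0 < x) by (unfold x; apply Rinv_0_lt_compat; lra).
  assert (Hx1 : x < 1) by nra.
  set (X := (x, 0) : point).
  assert (Hlat : forall t, ~ lattice_point (line X V t)).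
  { intros t [[n Hn] [m Hm]]. unfold line, add, scale, X, V in *. cbn [fst snd] in *.
    assert (E : IZR (1 + 2 * m * Z.of_nat a) = IZR (2 * n * Z.of_nat q)).
    { rewrite plus_IZR, !mult_IZR, <- !INR_IZR_INZ, <- Hn, <- Hm, <- Hx. ring. }
    apply eq_IZR in E. lia. }
  destruct (folded_line_billiard X V) as [B Hdir].
  { intro E. injection E. lra. }
  { exact Hlat. }
  { intros k t Hk E. destruct k; unfold V in E; cbn [height fst snd] in E; [lra| |lra].
    rewrite height_line in Hk. unfold V, X in Hk. cbn [height fst snd] in Hk.
    rewrite E, Rmult_0_r, Rplus_0_r in Hk. destruct Hk as [n Hn].
    assert (0 < n < 1)%Z; [|lia]. split; apply lt_IZR; lra. }
  set (alpha := fun t => fold (line X V t)) in *.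
  assert (H0 : forall h, in_tile (line X V h) -> alpha h = line X V h).
  { intros h Hh. unfold alpha. rewrite (fold_eq _ (Weyl Lid 0 0));
    replace (wact (Weyl Lid 0 0) (line X V h)) with (line X V h);
    trivial; generalize (line X V h); intro; symmetry; point_ring. }
  assert (HX : line X V 0 = X) by (unfold line, X, V; point_ring).
  assert (Ea : alpha 0 = X).
  { rewrite <- HX. apply H0. rewrite HX. unfold in_tile, X. cbn [fst snd]. lra. }
  exists alpha. split; [exact B|]. split; [|split; [|split]].
  - intro t. unfold alpha.
    destruct (fold_exists (line X V t)) as [w Hw].
    rewrite (fold_eq _ w Hw).
    destruct (wact_compose w (Weyl Lid (- Z.of_nat q) (Z.of_nat b))) as (w' & H1 & _).
    assert (E : wact w' (line X V (t + 1)) = wact w (line X V t)).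
    { rewrite H1. f_equal. unfold line, X, V, wact, add, scale.
      cbn [lin tb tk lact fst snd].
      rewrite plus_IZR, mult_IZR, opp_IZR, <- !INR_IZR_INZ.
      assert (INR q = INR a + 3 * INR b).
      { unfold q. rewrite plus_INR, mult_INR. simpl. ring. }
      apply injective_projections; cbn [fst snd]; lra. }
    rewrite (fold_eq _ w'); rewrite E; trivial.
  - rewrite Ea. reflexivity.
  - destruct (stays_in_tile X V) as (e & He & Hs).
    { intros []; unfold X, V; cbn [gap dgap fst snd]; [right|left|left]; lra. }
    exists e. split; [exact He|]. intros h Hh. rewrite Ea, Rplus_0_l.
    apply H0. unfold line. now apply Hs.
  - intros t v Hv. destruct (Hdir t) as [l Hl]. exists l. now apply Hl.
Qed.

(** * Symmetries of the tile and reversal of time *)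

(** The reflections of the tile are in its altitudes, which are perpendicular to the
    sides: their linear parts are the opposites of the [Lmir k]. *)
Definition tsign (l : linpart) : R := match l with Lmir _ => -1 | _ => 1 end.

Definition tshift (l : linpart) : point :=
  match l with
  | Lid | Lmir FCA => (0, 0)
  | Lrot | Lmir FAB => (0, 1)
  | Lrot2 | Lmir FBC => (1, 0)
  end.

(** The six affine symmetries of the tile, indexed by [linpart]. *)
Definition tile_sym (l : linpart) (X : point) : point :=
  add (scale (tsign l) (lact l X)) (tshift l).

Lemma tile_sym_in_tile l X : in_tile X -> in_tile (tile_sym l X).
Proof.
  destruct X as [i j]. unfold in_tile, tile_sym, add, scale.
  destruct l as [| | |[]]; cbn [tsign tshift lact fst snd]; lra.
Qed.

Lemma tile_sym_move l X h u :
  tile_sym l (add X (scale h u)) = add (tile_sym l X) (scale h (scale (tsign l) (lact l u))).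
Proof.
  unfold tile_sym. rewrite lact_add, lact_scale.
  generalize (lact l X), (lact l u), (tsign l), (tshift l). intros. point_ring.
Qed.

(** Symmetries of the tile permute the mirrors, though the rotations do not belong
    to W. *)
Lemma isZ_height_tile_sym l k X :
  isZ (height k (tile_sym l X)) <-> isZ (height (lfam l k) X).
Proof.
  assert (H : exists n, height k (tile_sym l X) = tsign l * height k (lact l X) + IZR n).
  { destruct X. unfold tile_sym, add, scale.
    destruct l as [| | |[]], k; cbn [tsign tshift lact height fst snd];
    first [exists 0%Z; ring | exists 1%Z; ring]. }
  destruct H as [n ->]. rewrite isZ_add_IZR.
  assert (E : tsign l * height k (lact l X) = height (lfam l k) X \/
              tsign l * height k (lact l X) = - height (lfam l k) X).
  { destruct (height_lact l k X) as [-> | ->], l; cbn [tsign];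
    first [left; ring | right; ring]. }
  destruct E as [-> | ->]; [reflexivity|apply isZ_opp].
Qed.

Lemma lattice_point_tile_sym l X : lattice_point (tile_sym l X) -> lattice_point X.
Proof.
  intro H. destruct (lfam_surj l FBC) as [k1 H1]. destruct (lfam_surj l FAB) as [k2 H2].
  split; [change (isZ (height FAB X)); rewrite <- H2
         |change (isZ (height FBC X)); rewrite <- H1];
  apply isZ_height_tile_sym, lattice_point_height, H.
Qed.

Lemma sub_as_add X h u : sub X (scale h u) = add X (scale (- h) u).
Proof. point_ring. Qed.

Lemma departs_tile_sym l beta t v :
  departs beta t v -> departs (fun t => tile_sym l (beta t)) t (scale (tsign l) (lact l v)).
Proof.
  intros (e & He & H). exists e. split; [exact He|]. intros h Hh.
  now rewrite H, tile_sym_move.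
Qed.

Lemma arrives_tile_sym l beta t v :
  arrives beta t v -> arrives (fun t => tile_sym l (beta t)) t (scale (tsign l) (lact l v)).
Proof.
  intros (e & He & H). exists e. split; [exact He|]. intros h Hh.
  now rewrite H, !sub_as_add, tile_sym_move.
Qed.

Lemma tsign_cases l : tsign l = 1 \/ tsign l = -1.
Proof. destruct l; cbn; auto. Qed.

Lemma scale_lact_nonzero c l v : c <> 0 -> v <> (0, 0) -> scale c (lact l v) <> (0, 0).
Proof.
  intros Hc Hv E. apply Hv. destruct (lact_inverse l) as [l' Hl].
  assert (E' : lact l v = (0, 0)).
  { apply (scale_reg c); [exact Hc|]. rewrite E. unfold scale; cbn [fst snd].
    now rewrite Rmult_0_r. }
  rewrite <- (Hl v), E'. destruct l' as [| | |[]]; cbn [lact]; f_equal; ring.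
Qed.

Lemma billiard_tile_sym l beta :
  lattice_billiard beta -> lattice_billiard (fun t => tile_sym l (beta t)).
Proof.
  intro B. split.
  - intro t. apply tile_sym_in_tile, (lb_tile _ B).
  - intros t H. apply lattice_point_tile_sym in H. now apply (lb_vertex _ B t).
  - intro t. destruct (lb_law _ B t) as (u & v & Hu & Hv & Hv0 & Hin & Hon).
    exists (scale (tsign l) (lact l u)), (scale (tsign l) (lact l v)).
    split; [now apply arrives_tile_sym|]. split; [now apply departs_tile_sym|].
    split; [|split].
    + apply scale_lact_nonzero; [destruct (tsign_cases l); lra|exact Hv0].
    + intro Hk. do 2 f_equal. apply Hin. intros k Hk'.
      destruct (lfam_surj l k) as [k' <-]. apply (Hk k'). now apply isZ_height_tile_sym.
    + intros k Hk. apply isZ_height_tile_sym in Hk. rewrite (Hon _ Hk).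
      now rewrite lact_scale, mirror_conj.
Qed.

Lemma reverse_arrives beta t v :
  departs beta (- t) v -> arrives (fun t => beta (- t)) t (scale (-1) v).
Proof.
  intros (e & He & H). exists e. split; [exact He|]. intros h Hh.
  replace (- (t - h)) with (- t + h) by ring. rewrite H by exact Hh.
  generalize (beta (- t)). intro. point_ring.
Qed.

Lemma reverse_departs beta t u :
  arrives beta (- t) u -> departs (fun t => beta (- t)) t (scale (-1) u).
Proof.
  intros (e & He & H). exists e. split; [exact He|]. intros h Hh.
  replace (- (t + h)) with (- t - h) by ring. rewrite H by exact Hh.
  generalize (beta (- t)). intro. point_ring.
Qed.

(** The reflections are involutions and commute with -1. *)
Lemma billiard_reverse beta :
  lattice_billiard beta -> lattice_billiard (fun t => beta (- t)).
Proof.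
  intro B. split; [intro; apply (lb_tile _ B)|intro; apply (lb_vertex _ B)|].
  intro t. destruct (lb_law _ B (- t)) as (u & v & Hu & Hv & Hv0 & Hin & Hon).
  exists (scale (-1) v), (scale (-1) u).
  split; [now apply reverse_arrives|]. split; [now apply reverse_departs|].
  assert (Hu0 : u <> (0, 0)).
  { intro E. apply Hv0. subst u.
    destruct (classic (exists k, isZ (height k (beta (- t))))) as [[k Hk]|Hk].
    - rewrite (Hon k Hk). destruct k; cbn [lact]; f_equal; ring.
    - apply Hin. intros k Hk'. apply Hk. now exists k. }
  split; [|split].
  - apply (scale_lact_nonzero (-1) Lid) in Hu0; [|lra]. now destruct u.
  - intro Hk. f_equal. symmetry. now apply Hin.
  - intros k Hk. rewrite (Hon k Hk), lact_scale, mirror_involutive. reflexivity.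
Qed.

(** Choose l and a sign that bring the velocity at time 0 into the sector, and a
    time t at which the unfolding line meets a mirror that l makes horizontal. At that
    time the trajectory strikes a side with an angle between 30 and 60 degrees. The sign
    is then the one of the symmetry of the tile with linear part l: the other one would
    make the trajectory leave the tile. *)
Lemma normal_start_time beta : lattice_billiard beta ->
  exists t l v, departs beta t v /\ snd (tile_sym l (beta t)) = 0 /\
    in_sector (scale (tsign l) (lact l v)).
Proof.
  intro B. destruct (billiard_departs beta 0 B) as [v0 Hv0].
  destruct (sector_exists v0 (departs_nonzero _ _ _ B Hv0)) as (l & e & He & Hsec).
  set (k := lfam l FBC).
  assert (Hk : height k v0 <> 0).
  { destruct (height_lact l FBC v0) as [E|E]; fold k in E;
    destruct Hsec as [_ Hsec], (lact l v0) as [x y]; unfold scale in Hsec;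
    cbn [height fst snd] in *; intro E0; rewrite E0 in E; rewrite E in Hsec;
    destruct He as [-> | ->]; lra. }
  (* the time at which the line meets the mirror of height 0 *)
  set (t := - height k (beta 0) / height k v0).
  assert (Ht : height k (line (beta 0) v0 (t - 0)) = 0).
  { rewrite height_line. unfold t. field. exact Hk. }
  destruct (unfolding_line beta 0 v0 t B Hv0) as (w & Hw1 & Hw2).
  destruct (billiard_departs beta t B) as [v Hv]. specialize (Hw2 v Hv).
  destruct (wact_compose (Weyl l 0 0) w) as (w' & H1 & H2). cbn [lin] in H2.
  set (l' := lin w') in *.
  set (beta' := fun t => tile_sym l' (beta t)).
  pose proof (billiard_tile_sym l' beta B) as B'. fold beta' in B'.
  pose proof (departs_tile_sym l' beta t v Hv) as Hv'. fold beta' in Hv'.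
  assert (H0 : snd (beta' t) = 0).
  { change (gap FBC (beta' t) = 0).
    apply (gap_lattice (beta' t) FBC (lb_tile _ B' t) (lb_vertex _ B' t)).
    apply isZ_height_tile_sym. apply isZ_height_wact. rewrite H1, Hw1.
    apply isZ_height_wact. cbn [lin]. fold k. rewrite Ht. now exists 0%Z. }
  exists t, l', v. split; [exact Hv|]. split; [exact H0|].
  pose proof (departs_inward beta' t _ FBC B' Hv' H0) as Hin. cbn [dgap] in Hin.
  rewrite H2, Hw2 in *. destruct (lact l v0) as [x y].
  unfold in_sector, scale in *; cbn [fst snd] in *.
  destruct He as [-> | ->], (tsign_cases l') as [Es|Es]; rewrite Es in Hin |- *; lra.
Qed.

(** * Euclidean geometry in lattice coordinates *)

Definition emb_vec (s : R) (u : point) : point :=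
  (s * (fst u + snd u / 2), s * (sqrt 3 / 2) * snd u).

Definition emb (o : point) (s : R) (X : point) : point := add o (emb_vec s X).

Definition coord_vec (s : R) (u : point) : point :=
  let j := snd u / (s * (sqrt 3 / 2)) in (fst u / s - j / 2, j).

Definition coord (o : point) (s : R) (X : point) : point := coord_vec s (sub X o).

(** The base can run in either direction, so the origin of the coordinates is its
    left end, which is B or C. *)
Definition framed (T : Triangle) (o : point) (s : R) : Prop :=
  0 < s /\ vA T = emb o s (0, 1) /\
  ((vB T = emb o s (0, 0) /\ vC T = emb o s (1, 0)) \/
   (vB T = emb o s (1, 0) /\ vC T = emb o s (0, 0))).

Lemma sqrt3_pos : 0 < sqrt 3.
Proof. apply sqrt_lt_R0. lra. Qed.

Lemma sqrt3_sqr : sqrt 3 * sqrt 3 = 3.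
Proof. apply sqrt_sqrt. lra. Qed.

Lemma framed_exists T : equilateral_on_horizontal_base T -> exists o s, framed T o s.
Proof.
  destruct T as [[ax ay] [bx by'] [cx cy]].
  unfold equilateral_on_horizontal_base, distance, norm, sub, dot; cbn [vA vB vC fst snd].
  intros (H1 & H2 & H3 & H4). subst cy.
  apply sqrt_inj in H1, H2; try (apply Rplus_le_le_0_compat; apply Rle_0_sqr).
  set (s := Rabs (cx - bx)).
  assert (Hss : s * s = (cx - bx) * (cx - bx)).
  { unfold s. rewrite <- Rabs_mult. apply Rabs_right. apply Rle_ge, Rle_0_sqr. }
  assert (Hs : 0 < s).
  { unfold s. apply Rabs_pos_lt. intro E.
    assert (0 < (ay - by') * (ay - by')) by (apply Rmult_lt_0_compat; lra).
    assert (0 <= (bx - ax) * (bx - ax)) by apply Rle_0_sqr. nra. }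
  (* the apex is above the midpoint of the base *)
  assert (Hax : 2 * ax = bx + cx).
  { assert (cx - bx <> 0) by (intro E; unfold s in Hs; rewrite E, Rabs_R0 in Hs; lra).
    apply (Rmult_eq_reg_l (cx - bx)); [|assumption]. lra. }
  pose proof sqrt3_pos. pose proof sqrt3_sqr.
  assert (Hay : ay - by' = s * (sqrt 3 / 2)).
  { assert (E : (ay - by' - s * (sqrt 3 / 2)) * (ay - by' + s * (sqrt 3 / 2)) = 0).
    { replace ((ay - by' - s * (sqrt 3 / 2)) * (ay - by' + s * (sqrt 3 / 2)))
        with ((ay - by') * (ay - by') - (s * s) * (sqrt 3 * sqrt 3) / 4) by field.
      rewrite sqrt3_sqr, Hss. replace ax with ((bx + cx) / 2) in * by lra.
      nra. }
    apply Rmult_integral in E as [E|E]; [lra|].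
    assert (0 < s * (sqrt 3 / 2)) by (apply Rmult_lt_0_compat; lra). lra. }
  unfold s, Rabs in *. destruct (Rcase_abs (cx - bx)) as [Hc|Hc].
  - exists (cx, by'), (- (cx - bx)). split; [exact Hs|]. cbn [vA vB vC].
    unfold emb, emb_vec, add; cbn [fst snd].
    split; [|right; split]; apply injective_projections; cbn [fst snd]; lra.
  - exists (bx, by'), (cx - bx). split; [exact Hs|]. cbn [vA vB vC].
    unfold emb, emb_vec, add; cbn [fst snd].
    split; [|left; split]; apply injective_projections; cbn [fst snd]; lra.
Qed.

(** The Euclidean scalar product in lattice coordinates, for unit side length. *)
Definition bil (u v : point) : R :=
  fst u * fst v + snd u * snd v + (fst u * snd v + snd u * fst v) / 2.

Lemma bil_nonneg u : 0 <= bil u u.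
Proof. destruct u as [a b]. unfold bil; cbn [fst snd]. nra. Qed.

Lemma bil_pos u : u <> (0, 0) -> 0 < bil u u.
Proof.
  destruct u as [a b]. unfold bil; cbn [fst snd]. intro H.
  destruct (Req_dec b 0) as [->|Hb].
  - assert (a <> 0) by (intros ->; now apply H).
    assert (0 < a * a) by (apply Rsqr_pos_lt; assumption). lra.
  - assert (0 < b * b) by (apply Rsqr_pos_lt; assumption).
    assert (0 <= (a + b / 2) * (a + b / 2)) by apply Rle_0_sqr. lra.
Qed.

Lemma bil_lact l u : bil (lact l u) (lact l u) = bil u u.
Proof. destruct u as [a b], l as [| | |[]]; unfold bil; cbn [lact fst snd]; field. Qed.

Lemma dot_emb s u v : dot (emb_vec s u) (emb_vec s v) = s * s * bil u v.
Proof.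
  unfold dot, emb_vec, bil; cbn [fst snd]. destruct u as [a b], v as [c d]; cbn [fst snd].
  replace (s * (a + b / 2) * (s * (c + d / 2)) + s * (sqrt 3 / 2) * b * (s * (sqrt 3 / 2) * d))
    with (s * s * ((a + b / 2) * (c + d / 2) + (sqrt 3 * sqrt 3) / 4 * b * d)) by field.
  rewrite sqrt3_sqr. field.
Qed.

Lemma norm_emb s u : 0 < s -> norm (emb_vec s u) = s * sqrt (bil u u).
Proof.
  intro Hs. unfold norm. rewrite dot_emb, sqrt_mult; [|nra|apply bil_nonneg].
  f_equal. apply sqrt_square. lra.
Qed.

Lemma emb_vec_sub s u v : emb_vec s (sub u v) = sub (emb_vec s u) (emb_vec s v).
Proof. destruct u, v. unfold emb_vec, sub; cbn [fst snd]. f_equal; field. Qed.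

Lemma emb_vec_scale s h u : emb_vec s (scale h u) = scale h (emb_vec s u).
Proof. destruct u. unfold emb_vec, scale; cbn [fst snd]. f_equal; field. Qed.

Lemma sub_emb o s X Y : sub (emb o s X) (emb o s Y) = emb_vec s (sub X Y).
Proof. rewrite emb_vec_sub. unfold emb. generalize (emb_vec s X), (emb_vec s Y). intros. point_ring. Qed.

Lemma emb_move o s X h u : emb o s (add X (scale h u)) = add (emb o s X) (scale h (emb_vec s u)).
Proof.
  destruct o, X, u. unfold emb, emb_vec, add, scale; cbn [fst snd]. f_equal; field.
Qed.

Lemma coord_vec_emb s u : 0 < s -> coord_vec s (emb_vec s u) = u.
Proof.
  intro Hs. pose proof sqrt3_pos. destruct u as [a b].
  unfold coord_vec, emb_vec; cbn [fst snd]. f_equal; field; lra.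
Qed.

Lemma emb_vec_coord s u : 0 < s -> emb_vec s (coord_vec s u) = u.
Proof.
  intro Hs. pose proof sqrt3_pos. destruct u as [a b].
  unfold coord_vec, emb_vec; cbn [fst snd]. f_equal; field; lra.
Qed.

Lemma coord_emb o s X : 0 < s -> coord o s (emb o s X) = X.
Proof.
  intro Hs. unfold coord, emb. rewrite <- (coord_vec_emb s X Hs) at 2. f_equal.
  generalize (emb_vec s X). intro. point_ring.
Qed.

Lemma emb_coord o s X : 0 < s -> emb o s (coord o s X) = X.
Proof. intro Hs. unfold coord, emb. rewrite emb_vec_coord by exact Hs. point_ring. Qed.

Lemma coord_move o s X h u : 0 < s ->
  coord o s (add X (scale h u)) = add (coord o s X) (scale h (coord_vec s u)).
Proof.
  intro Hs. pose proof sqrt3_pos. destruct o, X, u. unfold coord, coord_vec, add, sub, scale; cbn [fst snd].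
  f_equal; field; lra.
Qed.

Lemma departs_coord o s alpha t v : 0 < s ->
  departs alpha t v -> departs (fun t => coord o s (alpha t)) t (coord_vec s v).
Proof.
  intros Hs (e & He & H). exists e. split; [exact He|]. intros h Hh.
  now rewrite H, coord_move.
Qed.

Lemma arrives_coord o s alpha t v : 0 < s ->
  arrives alpha t v -> arrives (fun t => coord o s (alpha t)) t (coord_vec s v).
Proof.
  intros Hs (e & He & H). exists e. split; [exact He|]. intros h Hh.
  now rewrite H, !sub_as_add, coord_move.
Qed.

Lemma departs_emb o s alpha t v : 0 < s ->
  departs (fun t => coord o s (alpha t)) t v -> departs alpha t (emb_vec s v).
Proof.
  intros Hs (e & He & H). exists e. split; [exact He|]. intros h Hh.
  rewrite <- (emb_coord o s (alpha (t + h)) Hs), H, emb_move, emb_coord; auto.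
Qed.

Lemma arrives_emb o s alpha t v : 0 < s ->
  arrives (fun t => coord o s (alpha t)) t v -> arrives alpha t (emb_vec s v).
Proof.
  intros Hs (e & He & H). exists e. split; [exact He|]. intros h Hh.
  rewrite <- (emb_coord o s (alpha (t - h)) Hs), H, !sub_as_add, emb_move, emb_coord; auto.
Qed.

(** A lattice vector along the mirrors of direction k. *)
Definition direction (k : mirror_family) : point :=
  match k with FBC => (1, 0) | FAB => (0, 1) | FCA => (1, -1) end.

Lemma mirror_emb s k c u : 0 < s -> c <> 0 ->
  mirror (emb_vec s (scale c (direction k))) (emb_vec s u) = emb_vec s (lact (Lmir k) u).
Proof.
  intros Hs Hc. unfold mirror. rewrite !dot_emb, <- emb_vec_scale, <- emb_vec_sub. f_equal.
  replace (bil (scale c (direction k)) (scale c (direction k))) with (c * c)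
    by (destruct k; unfold bil, scale, direction; cbn [fst snd]; field).
  destruct u as [a b], k; unfold bil, scale, sub, direction; cbn [lact fst snd];
  apply injective_projections; cbn [fst snd]; field; repeat split; lra.
Qed.

Lemma on_segment_emb o s P Q X : 0 < s ->
  (on_segment (emb o s P) (emb o s Q) X <-> on_segment P Q (coord o s X)).
Proof.
  intro Hs.
  assert (E : forall r, add (scale (1 - r) (emb o s P)) (scale r (emb o s Q)) =
                        emb o s (add (scale (1 - r) P) (scale r Q))).
  { intro r. destruct o, P, Q. unfold emb, emb_vec, add, scale; cbn [fst snd]. f_equal; field. }
  split; intros (r & Hr & H); exists r; (split; [exact Hr|]).
  - rewrite H, E. now apply coord_emb.
  - rewrite E, <- H. symmetry. now apply emb_coord.
Qed.

Definition tile_side (k : mirror_family) : point * point :=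
  match k with
  | FBC => ((0, 0), (1, 0)) | FAB => ((0, 0), (0, 1)) | FCA => ((0, 1), (1, 0))
  end.

Lemma on_segment_sym P Q X : on_segment P Q X -> on_segment Q P X.
Proof. intros (r & Hr & ->). exists (1 - r). split; [lra|]. point_ring. Qed.

Lemma on_tile_side k X :
  on_segment (fst (tile_side k)) (snd (tile_side k)) X <-> in_tile X /\ gap k X = 0.
Proof.
  destruct X as [i j]. unfold on_segment, in_tile, add, scale.
  destruct k; cbn [tile_side gap fst snd]; split.
  - intros (r & Hr & H). injection H as -> ->. lra.
  - intros [H1 H2]. exists i. split; [lra|]. apply injective_projections; cbn [fst snd]; lra.
  - intros (r & Hr & H). injection H as -> ->. lra.
  - intros [H1 H2]. exists j. split; [lra|]. apply injective_projections; cbn [fst snd]; lra.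
  - intros (r & Hr & H). injection H as -> ->. lra.
  - intros [H1 H2]. exists i. split; [lra|]. apply injective_projections; cbn [fst snd]; lra.
Qed.

Definition side_of (o : point) (s : R) (k : mirror_family) (E F : point) : Prop :=
  (E = emb o s (fst (tile_side k)) /\ F = emb o s (snd (tile_side k))) \/
  (E = emb o s (snd (tile_side k)) /\ F = emb o s (fst (tile_side k))).

Lemma side_of_on_segment o s k E F X : 0 < s -> side_of o s k E F ->
  (on_segment E F X <-> in_tile (coord o s X) /\ gap k (coord o s X) = 0).
Proof.
  intros Hs H. rewrite <- on_tile_side, <- on_segment_emb by exact Hs.
  destruct H as [[-> ->]|[-> ->]]; [reflexivity|]. split; apply on_segment_sym.
Qed.

Lemma side_of_mirror o s k E F u : 0 < s -> side_of o s k E F ->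
  mirror (sub F E) (emb_vec s u) = emb_vec s (lact (Lmir k) u).
Proof.
  intros Hs H.
  assert (Hd : exists c, c <> 0 /\ sub F E = emb_vec s (scale c (direction k))).
  { destruct H as [[-> ->]|[-> ->]].
    - exists 1. split; [lra|].
      rewrite sub_emb. f_equal. unfold sub, scale.
      destruct k; cbn [tile_side direction fst snd]; f_equal; ring.
    - exists (-1). split; [lra|].
      rewrite sub_emb. f_equal. unfold sub, scale.
      destruct k; cbn [tile_side direction fst snd]; f_equal; ring. }
  destruct Hd as (c & Hc & ->). now apply mirror_emb.
Qed.

(** The cosines of 60 and 30 degrees have squares 1/4 and 3/4; squaring avoids the
    square roots in lengths. *)
Lemma angle_window x :
  0 <= x <= 1 -> (PI / 6 <= acos x <= PI / 3 <-> 1 / 4 <= x * x <= 3 / 4).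
Proof.
  intro Hx. pose proof PI_RGT_0. pose proof sqrt3_pos. pose proof sqrt3_sqr.
  pose proof (acos_bound x) as Hb. pose proof (cos_acos x ltac:(lra)) as Hc.
  split; intros [H2 H3].
  - assert (L1 : 1 / 2 <= x).
    { rewrite <- cos_PI3, <- Hc. apply cos_decr_1; lra. }
    assert (L2 : x <= sqrt 3 / 2).
    { rewrite <- cos_PI6. rewrite <- Hc at 1. apply cos_decr_1; lra. }
    nra.
  - assert (L1 : 1 / 2 <= x) by nra.
    assert (L2 : x <= sqrt 3 / 2) by nra.
    split.
    + apply cos_decr_0; try lra. rewrite Hc, cos_PI6. exact L2.
    + apply cos_decr_0; try lra. rewrite Hc, cos_PI3. exact L1.
Qed.

(** * Enumerating strike times *)

Lemma sort_list (l : list R) : NoDup l ->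
  exists l', Permutation l l' /\ StronglySorted Rlt l'.
Proof.
  assert (Hins : forall x l, ~ In x l -> StronglySorted Rlt l ->
    exists l', Permutation (x :: l) l' /\ StronglySorted Rlt l').
  { clear l. intros x l. induction l as [|y l IH]; intros Hx Hl.
    - exists (x :: nil). split; [reflexivity|]. repeat constructor.
    - apply StronglySorted_inv in Hl as [Hl Hy].
      destruct (Rtotal_order x y) as [H|[H|H]].
      + exists (x :: y :: l). split; [reflexivity|]. constructor; [now constructor|].
        constructor; [exact H|]. eapply Forall_impl; [|exact Hy]. intros; simpl in *; lra.
      + exfalso. apply Hx. now left.
      + destruct IH as (l' & Hp & Hs); [intro; apply Hx; now right|exact Hl|].
        exists (y :: l'). split; [rewrite perm_swap; now constructor|].
        constructor; [exact Hs|]. eapply Permutation_Forall; [exact Hp|].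
        constructor; assumption. }
  induction l as [|x l IH]; intro ND.
  - exists nil. split; constructor.
  - apply NoDup_cons_iff in ND as [Hx ND]. destruct (IH ND) as (l' & Hp & Hs).
    destruct (Hins x l') as (l'' & Hp' & Hs').
    { intro H. apply Hx. now apply (Permutation_in _ (Permutation_sym Hp)). }
    { exact Hs. }
    exists l''. split; [|exact Hs']. rewrite <- Hp'. now constructor.
Qed.

Lemma StronglySorted_nth (l : list R) d i j :
  StronglySorted Rlt l -> (i < j < length l)%nat -> nth i l d < nth j l d.
Proof.
  intro H. revert i j. induction H as [|x l Hl IH Hx]; intros i j Hij; simpl in Hij; [lia|].
  destruct j as [|j]; [lia|]. destruct i as [|i]; simpl.
  - rewrite Forall_forall in Hx. apply Hx, nth_In. lia.
  - apply IH. lia.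
Qed.

Lemma StronglySorted_snoc (l : list R) x :
  StronglySorted Rlt l -> (forall y, In y l -> y < x) -> StronglySorted Rlt (l ++ x :: nil).
Proof.
  induction 1 as [|y l Hl IH Hy]; intro H; simpl.
  - repeat constructor.
  - constructor.
    + apply IH. intros z Hz. apply H. now right.
    + apply Forall_app. split; [exact Hy|]. constructor; [|constructor]. apply H. now left.
Qed.

(** Sort the finite list of strikes and append the final time. *)
Lemma strike_times_exist T ob l :
  NoDup l -> (forall t, In t l <-> (start ob <= t < stop ob /\ boundary T (path ob t))) ->
  start ob < stop ob -> boundary T (path ob (start ob)) -> boundary T (path ob (stop ob)) ->
  exists m t, strike_times T ob m t.
Proof.
  intros ND Hl Hlt Hb Hb'. destruct (sort_list l ND) as (l' & Hp & Hsort).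
  set (L := l' ++ stop ob :: nil). exists (length l'), (fun k => nth k L 0).
  assert (HinL : forall s, In s L <-> (start ob <= s <= stop ob /\ boundary T (path ob s))).
  { intro s. unfold L. rewrite in_app_iff. split.
    - intros [H|[<-|[]]].
      + apply (Permutation_in _ (Permutation_sym Hp)), Hl in H. split; [lra|apply H].
      + split; [lra|exact Hb'].
    - intros [H1 H2]. destruct (Req_dec s (stop ob)) as [->|Hne]; [right; now left|].
      left. apply (Permutation_in _ Hp), Hl. split; [lra|exact H2]. }
  assert (HS : StronglySorted Rlt L).
  { apply StronglySorted_snoc; [exact Hsort|]. intros y Hy.
    apply (Permutation_in _ (Permutation_sym Hp)), Hl in Hy. lra. }
  assert (Hlen : length L = S (length l')) by (unfold L; rewrite length_app; simpl; lia).
  split; [|split; [|split]].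
  - assert (H0 : In (nth 0 L 0) L) by (apply nth_In; lia). apply HinL in H0.
    assert (H1 : In (start ob) L) by (apply HinL; split; [lra|exact Hb]).
    destruct (In_nth _ _ 0 H1) as (k & Hk & E). destruct k as [|k]; [exact E|].
    pose proof (StronglySorted_nth L 0 0 (S k) HS ltac:(lia)). lra.
  - unfold L. rewrite app_nth2, Nat.sub_diag by lia. reflexivity.
  - intros k Hk. apply StronglySorted_nth; [exact HS|lia].
  - intros s Hs. split.
    + intro H. assert (H1 : In s L) by (apply HinL; now split).
      destruct (In_nth _ _ 0 H1) as (k & Hk & E). exists k. split; [lia|now symmetry].
    + intros (k & Hk & ->). apply (HinL (nth k L 0)). apply nth_In. lia.
Qed.

(** * Billiards in an equilateral triangle *)

Section Frame.
Variables (T : Triangle) (o : point) (s : R).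
Hypothesis HT : framed T o s.
Let Hs : 0 < s.
Proof. exact (proj1 HT). Qed.
Local Notation co := (coord o s).

Lemma is_side_side_of E F : is_side T E F -> exists k, side_of o s k E F.
Proof.
  pose proof HT as (_ & HA & HBC). unfold is_side. rewrite HA.
  destruct HBC as [[-> ->]|[-> ->]]; intros [[-> ->]|[[-> ->]|[-> ->]]];
  first [exists FBC; unfold side_of; tauto | exists FAB; unfold side_of; tauto
        | exists FCA; unfold side_of; tauto].
Qed.

Lemma side_of_is_side k : exists E F, is_side T E F /\ side_of o s k E F.
Proof.
  pose proof HT as (_ & HA & HBC). unfold is_side, side_of. rewrite HA.
  destruct HBC as [[-> ->]|[-> ->]], k; cbn [tile_side fst snd].
  - exists (emb o s (0, 0)), (emb o s (1, 0)). tauto.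
  - exists (emb o s (0, 1)), (emb o s (0, 0)). tauto.
  - exists (emb o s (1, 0)), (emb o s (0, 1)). tauto.
  - exists (emb o s (1, 0)), (emb o s (0, 0)). tauto.
  - exists (emb o s (0, 0)), (emb o s (0, 1)). tauto.
  - exists (emb o s (0, 1)), (emb o s (1, 0)). tauto.
Qed.

Lemma boundary_coord X : boundary T X <-> in_tile (co X) /\ exists k, gap k (co X) = 0.
Proof.
  split.
  - intros (E & F & HE & HX). destruct (is_side_side_of E F HE) as [k Hk].
    apply (side_of_on_segment o s k E F X Hs Hk) in HX. split; [apply HX|].
    exists k. apply HX.
  - intros [HX [k Hk]]. destruct (side_of_is_side k) as (E & F & HE & HF).
    exists E, F. split; [exact HE|]. now apply (side_of_on_segment o s k).
Qed.

(** This removes the sides from the description of a trajectory. *)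
Lemma boundary_height X : in_tile (co X) -> ~ lattice_point (co X) ->
  (boundary T X <-> exists k, isZ (height k (co X))).
Proof.
  intros H1 H2. rewrite boundary_coord. split.
  - intros [_ [k Hk]]. exists k. now apply gap_lattice.
  - intros [k Hk]. split; [exact H1|]. exists k. now apply gap_lattice.
Qed.

Lemma region_coord X : region T X <-> in_tile (co X).
Proof.
  pose proof HT as (_ & HA & HBC). unfold region. rewrite HA.
  assert (E : forall x y z, x + y + z = 1 ->
    add (scale x (emb o s (0, 1))) (add (scale y (emb o s (0, 0))) (scale z (emb o s (1, 0))))
    = emb o s (z, x)).
  { intros x y z Hxyz. replace y with (1 - x - z) by lra. destruct o.
    unfold emb, emb_vec, add, scale; cbn [fst snd]. f_equal; field. }
  assert (E' : forall x y z, x + y + z = 1 ->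
    add (scale x (emb o s (0, 1))) (add (scale y (emb o s (1, 0))) (scale z (emb o s (0, 0))))
    = emb o s (y, x)).
  { intros x y z Hxyz. replace z with (1 - x - y) by lra. destruct o.
    unfold emb, emb_vec, add, scale; cbn [fst snd]. f_equal; field. }
  destruct HBC as [[-> ->]|[-> ->]]; split.
  - intros (x & y & z & Hx & Hy & Hz & Hxyz & ->). rewrite E, coord_emb by assumption.
    unfold in_tile; cbn [fst snd]. lra.
  - unfold in_tile. intro H. exists (snd (co X)), (1 - fst (co X) - snd (co X)), (fst (co X)).
    repeat split; try lra. rewrite E by lra. rewrite <- surjective_pairing.
    symmetry. now apply emb_coord.
  - intros (x & y & z & Hx & Hy & Hz & Hxyz & ->). rewrite E', coord_emb by assumption.
    unfold in_tile; cbn [fst snd]. lra.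
  - unfold in_tile. intro H. exists (snd (co X)), (fst (co X)), (1 - fst (co X) - snd (co X)).
    repeat split; try lra. rewrite E' by lra. rewrite <- surjective_pairing.
    symmetry. now apply emb_coord.
Qed.

Lemma emb_coord_eq X Y : X = emb o s Y <-> co X = Y.
Proof. split; [intros ->; now apply coord_emb|intros <-; symmetry; now apply emb_coord]. Qed.

Lemma vertex_coord X : is_vertex T X <-> co X = (0, 1) \/ co X = (0, 0) \/ co X = (1, 0).
Proof.
  pose proof HT as (_ & HA & HBC). unfold is_vertex. rewrite HA.
  destruct HBC as [[-> ->]|[-> ->]]; rewrite !emb_coord_eq; tauto.
Qed.

Lemma vertex_lattice X : in_tile (co X) -> (is_vertex T X <-> lattice_point (co X)).
Proof.
  intro H. rewrite vertex_coord. destruct (co X) as [i j].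
  unfold in_tile in H; cbn [fst snd] in H. split.
  - intros [E|[E|E]]; injection E as -> ->; split; cbn [fst snd];
    first [now exists 0%Z|now exists 1%Z].
  - intros [[n Hn] [m Hm]]; cbn [fst snd] in *. subst i j.
    rewrite <- plus_IZR in H. destruct H as (H1 & H2 & H3).
    apply le_IZR in H1, H2, H3.
    assert (n = 0 /\ m = 1 \/ n = 0 /\ m = 0 \/ n = 1 /\ m = 0)%Z
      as [[-> ->]|[[-> ->]|[-> ->]]] by lia; auto.
Qed.

Lemma trajectory_coord alpha :
  nonsingular_trajectory T alpha -> lattice_billiard (fun t => co (alpha t)).
Proof.
  intros (Hreg & Hver & speed & Hsp & H).
  assert (Hin : forall t, in_tile (co (alpha t))) by (intro t; now apply region_coord).
  assert (Hnl : forall t, ~ lattice_point (co (alpha t))).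
  { intros t Hl. apply (Hver t). now apply vertex_lattice. }
  split; [exact Hin|exact Hnl|]. intro t.
  destruct (H t) as (u & v & Hu & Hv & Nu & Nv & Hint & Hbd).
  exists (coord_vec s u), (coord_vec s v).
  split; [now apply arrives_coord|]. split; [now apply departs_coord|]. split; [|split].
  - intro E. rewrite <- (emb_vec_coord s v Hs), E, norm_emb in Nv by exact Hs.
    unfold bil in Nv; cbn [fst snd] in Nv.
    replace (0 * 0 + 0 * 0 + (0 * 0 + 0 * 0) / 2) with 0 in Nv by field.
    rewrite sqrt_0 in Nv. lra.
  - intro Hk. f_equal. apply Hint. rewrite boundary_height by auto.
    intros [k Hk']. now apply (Hk k).
  - intros k Hk. destruct (side_of_is_side k) as (E & F & HE & HF).
    rewrite (Hbd E F HE).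
    + rewrite <- (emb_vec_coord s u Hs) at 1.
      rewrite (side_of_mirror o s k E F) by assumption. now apply coord_vec_emb.
    + apply (side_of_on_segment o s k); trivial. split; [apply Hin|].
      now apply gap_lattice.
Qed.

(** All velocities are images of one vector V under isometries, whence the constant
    speed. *)
Lemma trajectory_emb beta V :
  lattice_billiard beta -> (forall t v, departs beta t v -> exists l, v = lact l V) ->
  nonsingular_trajectory T (fun t => emb o s (beta t)).
Proof.
  intros B HV.
  assert (Hco : forall t, co (emb o s (beta t)) = beta t) by (intro; now apply coord_emb).
  assert (Hin : forall t, in_tile (co (emb o s (beta t)))).
  { intro t. rewrite Hco. apply (lb_tile _ B). }
  assert (Hnl : forall t, ~ lattice_point (co (emb o s (beta t)))).
  { intro t. rewrite Hco. apply (lb_vertex _ B). }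
  assert (Hfun : (fun t => co (emb o s (beta t))) = beta) by (apply functional_extensionality, Hco).
  assert (HVpos : 0 < bil V V).
  { destruct (lb_law _ B 0) as (u & v & _ & Hv & Hv0 & _).
    destruct (HV 0 v Hv) as [l Hl]. rewrite <- (bil_lact l V), <- Hl. now apply bil_pos. }
  split; [intro t; now apply region_coord|].
  split; [intros t Hv; apply (Hnl t); now apply vertex_lattice|].
  exists (s * sqrt (bil V V)). split; [apply Rmult_lt_0_compat; [exact Hs|now apply sqrt_lt_R0]|].
  intro t. destruct (lb_law _ B t) as (u & v & Hu & Hv & Hv0 & Hint & Hon).
  destruct (HV t v Hv) as [l Hl].
  assert (Nv : bil v v = bil V V) by (rewrite Hl; apply bil_lact).
  assert (Nu : bil u u = bil v v).
  { destruct (classic (exists k, isZ (height k (beta t)))) as [[k Hk]|Hk].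
    - rewrite (Hon k Hk). symmetry. apply bil_lact.
    - rewrite Hint; [reflexivity|]. intros k Hk'. apply Hk. now exists k. }
  exists (emb_vec s u), (emb_vec s v). rewrite !norm_emb, Nu, Nv by exact Hs.
  split; [|split; [|split; [reflexivity|split; [reflexivity|split]]]].
  - apply (arrives_emb o); [exact Hs|]. now rewrite Hfun.
  - apply (departs_emb o); [exact Hs|]. now rewrite Hfun.
  - intro Hnb. f_equal. apply Hint. intros k Hk. apply Hnb.
    apply boundary_height; auto. exists k. now rewrite Hco.
  - intros E F HE HX. destruct (is_side_side_of E F HE) as [k Hk].
    rewrite (side_of_mirror o s k E F u Hs Hk). f_equal. apply Hon.
    apply (side_of_on_segment o s k E F _ Hs Hk) in HX. rewrite Hco in HX.
    apply gap_lattice; [apply (lb_tile _ B)|apply (lb_vertex _ B)|apply HX].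
Qed.

Lemma sub_coord X Y : sub X Y = emb_vec s (sub (co X) (co Y)).
Proof.
  rewrite <- (emb_coord o s X Hs) at 1. rewrite <- (emb_coord o s Y Hs) at 1.
  apply sub_emb.
Qed.

Lemma distance_coord X Y :
  distance X Y = s * sqrt (bil (sub (co Y) (co X)) (sub (co Y) (co X))).
Proof. unfold distance. rewrite sub_coord. now apply norm_emb. Qed.

Lemma distance_eq_coord X Y X' Y' :
  distance X Y = distance X' Y' <->
  bil (sub (co Y) (co X)) (sub (co Y) (co X)) = bil (sub (co Y') (co X')) (sub (co Y') (co X')).
Proof.
  rewrite !distance_coord. split; intro H.
  - apply Rmult_eq_reg_l in H; [|lra]. apply sqrt_inj in H; trivial; apply bil_nonneg.
  - now rewrite H.
Qed.

(** An isometry that permutes the vertices is determined by its values there, since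
    the distances to three non-collinear points determine a point. It is not assumed
    that a symmetry is affine. *)
Lemma triangle_symmetry_coord g :
  triangle_symmetry T g -> exists l, forall X, co (g X) = tile_sym l (co X).
Proof.
  intros [Hd Hv].
  set (P := fun x => co (g (emb o s x))).
  assert (HP : forall x y, bil (sub (P y) (P x)) (sub (P y) (P x)) = bil (sub y x) (sub y x)).
  { intros x y. pose proof (proj1 (distance_eq_coord _ _ _ _) (Hd (emb o s x) (emb o s y))) as H.
    rewrite !(coord_emb o s _ Hs) in H. exact H. }
  assert (HPv : forall x, x = (0, 1) \/ x = (0, 0) \/ x = (1, 0) ->
                          P x = (0, 1) \/ P x = (0, 0) \/ P x = (1, 0)).
  { intros x Hx. apply (vertex_coord), Hv, (vertex_coord).
    now rewrite coord_emb. }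
  assert (HPg : forall l, (forall x, P x = tile_sym l x) -> exists l, forall X, co (g X) = tile_sym l (co X)).
  { intros l H. exists l. intro X. rewrite <- H. unfold P. now rewrite emb_coord. }
  (* images of A, B, C: two equal images contradict the distances, and six cases remain *)
  destruct (HPv (0, 1)) as [EA|[EA|EA]]; [auto| | |];
  (destruct (HPv (0, 0)) as [EB|[EB|EB]]; [auto| | |]);
  (destruct (HPv (1, 0)) as [EC|[EC|EC]]; [auto| | |]);
  try (exfalso; pose proof (HP (0, 1) (0, 0)) as H1; pose proof (HP (0, 1) (1, 0)) as H2;
       pose proof (HP (0, 0) (1, 0)) as H3; rewrite ?EA, ?EB, ?EC in *;
       unfold bil, sub in *; cbn [fst snd] in *; lra);
  [apply (HPg Lid)|apply (HPg (Lmir FBC))|apply (HPg (Lmir FAB))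
  |apply (HPg Lrot2)|apply (HPg Lrot)|apply (HPg (Lmir FCA))];
  intro x; pose proof (HP (0, 1) x) as H1; pose proof (HP (0, 0) x) as H2;
  pose proof (HP (1, 0) x) as H3; rewrite ?EA, ?EB, ?EC in *; clear - H1 H2 H3;
  destruct (P x) as [i' j'], x as [i j]; unfold bil, sub, tile_sym, add, scale in *;
  cbn [lact tsign tshift fst snd] in *; apply injective_projections; cbn [fst snd]; lra.
Qed.

Lemma tile_sym_symmetry l : triangle_symmetry T (fun X => emb o s (tile_sym l (co X))).
Proof.
  split.
  - intros X Y. apply distance_eq_coord. rewrite !coord_emb by exact Hs.
    assert (E : sub (tile_sym l (co Y)) (tile_sym l (co X)) =
                scale (tsign l) (lact l (sub (co Y) (co X)))).
    { unfold tile_sym. rewrite lact_sub.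
      generalize (lact l (co Y)), (lact l (co X)), (tshift l). intros. point_ring. }
    rewrite E, <- (bil_lact l (sub (co Y) (co X))).
    generalize (lact l (sub (co Y) (co X))). intros [a b].
    destruct (tsign_cases l) as [-> | ->]; unfold bil, scale; cbn [fst snd]; field.
  - intros V. rewrite !(vertex_coord), coord_emb by exact Hs.
    unfold tile_sym, add, scale.
    intros [-> |[-> | ->]]; destruct l as [| | |[]]; cbn [lact tsign tshift fst snd];
    first [left; apply injective_projections; cbn [fst snd]; lra
          |right; left; apply injective_projections; cbn [fst snd]; lra
          |right; right; apply injective_projections; cbn [fst snd]; lra].
Qed.

Lemma tess_vertex_coord X : tess_vertex T X <-> lattice_point (co X).
Proof.
  pose proof HT as (_ & HA & HBC). unfold tess_vertex. rewrite HA.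
  assert (E : forall i j, add (emb o s (0, 0)) (add (scale i (sub (emb o s (1, 0)) (emb o s (0, 0))))
     (scale j (sub (emb o s (0, 1)) (emb o s (0, 0))))) = emb o s (i, j)).
  { intros i j. rewrite !sub_emb. destruct o. unfold emb, emb_vec, add, sub, scale; cbn [fst snd].
    f_equal; field. }
  assert (E' : forall i j, add (emb o s (1, 0)) (add (scale i (sub (emb o s (0, 0)) (emb o s (1, 0))))
     (scale j (sub (emb o s (0, 1)) (emb o s (1, 0))))) = emb o s (1 - i - j, j)).
  { intros i j. rewrite !sub_emb. destruct o. unfold emb, emb_vec, add, sub, scale; cbn [fst snd].
    f_equal; field. }
  destruct HBC as [[-> ->]|[-> ->]]; split.
  - intros (i & j & ->). rewrite E, coord_emb by exact Hs. split; [now exists i|now exists j].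
  - intros [[i Hi] [j Hj]]. exists i, j. rewrite E, emb_coord_eq by exact HT.
    rewrite <- Hi, <- Hj. apply surjective_pairing.
  - intros (i & j & ->). rewrite E', coord_emb by exact Hs.
    split; [exists (1 - i - j)%Z; cbn [fst]; now rewrite !minus_IZR|now exists j].
  - intros [[i Hi] [j Hj]]. exists (1 - i - j)%Z, j. rewrite E', emb_coord_eq by exact HT.
    apply injective_projections; cbn [fst snd]; rewrite ?minus_IZR; lra.
Qed.

Lemma bil_side : bil (sub (co (vC T)) (co (vB T))) (sub (co (vC T)) (co (vB T))) = 1.
Proof.
  pose proof HT as (_ & HA & HBC).
  destruct HBC as [[-> ->]|[-> ->]]; rewrite !coord_emb by exact Hs;
  unfold bil, sub; cbn [fst snd]; field.
Qed.

Lemma tess_edge_coord E F : tess_edge T E F <->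
  lattice_point (co E) /\ lattice_point (co F) /\ bil (sub (co F) (co E)) (sub (co F) (co E)) = 1.
Proof.
  unfold tess_edge. rewrite !tess_vertex_coord, distance_eq_coord, bil_side. reflexivity.
Qed.

(** The integer vectors (a, b) with a^2 + ab + b^2 = 1 are the six units of the
    hexagonal lattice. *)
Lemma tess_edge_direction E F : tess_edge T E F ->
  exists k n c, c <> 0 /\ sub (co F) (co E) = scale c (direction k) /\
    height k (co E) = IZR n.
Proof.
  rewrite tess_edge_coord. destruct (co E) as [x y], (co F) as [x' y'].
  intros ([[i Hi] [j Hj]] & [[i' Hi'] [j' Hj']] & H). cbn [fst snd] in *. subst x y x' y'.
  unfold sub, bil, scale in *; cbn [fst snd] in *. rewrite <- !minus_IZR in *.
  set (a := (i' - i)%Z) in *. set (b := (j' - j)%Z) in *. clearbody a b.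
  assert (Hab : (a * a + b * b + a * b = 1)%Z).
  { apply eq_IZR. rewrite !plus_IZR, !mult_IZR. lra. }
  assert (Hb : (-1 <= b <= 1)%Z) by nia. assert (Ha : (-1 <= a <= 1)%Z) by nia.
  assert (a = 1 /\ b = 0 \/ a = -1 /\ b = 0 \/ a = 0 /\ b = 1 \/ a = 0 /\ b = -1 \/
          a = 1 /\ b = -1 \/ a = -1 /\ b = 1)%Z
    as [[-> ->]|[[-> ->]|[[-> ->]|[[-> ->]|[[-> ->]|[-> ->]]]]]] by nia.
  - exists FBC, j, 1. cbn [direction height fst snd]. repeat split; [lra|f_equal; lra].
  - exists FBC, j, (-1). cbn [direction height fst snd]. repeat split; [lra|f_equal; lra].
  - exists FAB, i, 1. cbn [direction height fst snd]. repeat split; [lra|f_equal; lra].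
  - exists FAB, i, (-1). cbn [direction height fst snd]. repeat split; [lra|f_equal; lra].
  - exists FCA, (i + j)%Z, 1. cbn [direction height fst snd]. rewrite plus_IZR. repeat split; [lra|f_equal; lra].
  - exists FCA, (i + j)%Z, (-1). cbn [direction height fst snd]. rewrite plus_IZR. repeat split; [lra|f_equal; lra].
Qed.

(** The reflection in an edge is an element of W, and only its mirror matters. *)
Lemma tess_edge_reflect E F : tess_edge T E F -> exists k n,
  (forall X, co (reflect E F X) = wact (mirror_in k n) (co X)) /\
  (forall X, on_segment E F X -> height k (co X) = IZR n).
Proof.
  intro HEF. destruct (tess_edge_direction E F HEF) as (k & n & c & Hc & Hd & Hn).
  exists k, n. split.
  - intro X. unfold reflect. rewrite (sub_coord F E), (sub_coord X E), Hd, mirror_emb by assumption.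
    rewrite <- (emb_coord o s E Hs) at 1.
    replace (add (emb o s (co E)) (emb_vec s (lact (Lmir k) (sub (co X) (co E)))))
      with (emb o s (add (co E) (scale 1 (lact (Lmir k) (sub (co X) (co E)))))).
    + rewrite coord_emb by exact Hs.
      rewrite <- (mirror_in_fixes k n (co E) Hn) at 1.
      rewrite <- (lin_mirror_in k n), <- wact_move. f_equal.
      generalize (co X), (co E). intros. point_ring.
    + rewrite emb_move. f_equal. generalize (emb_vec s (lact (Lmir k) (sub (co X) (co E)))).
      intro. point_ring.
  - intros X HX. rewrite <- (emb_coord o s E Hs), <- (emb_coord o s F Hs) in HX.
    apply (on_segment_emb o s _ _ _ Hs) in HX. destruct HX as (r & _ & ->).
    rewrite <- Hn.
    assert (H0 : height k (sub (co F) (co E)) = 0).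
    { rewrite Hd. destruct k; unfold scale; cbn [direction height fst snd]; ring. }
    destruct (co E), (co F), k; unfold add, sub, scale in *; cbn [height fst snd] in *; nra.
Qed.

Lemma tess_edge_through X k n : height k (co X) = IZR n ->
  exists E F, tess_edge T E F /\ on_segment E F X.
Proof.
  intro Hk.
  assert (H : exists P Q, lattice_point P /\ lattice_point Q /\
     bil (sub Q P) (sub Q P) = 1 /\ on_segment P Q (co X)).
  { destruct (co X) as [i j]. unfold lattice_point, bil, sub, on_segment, add, scale.
    destruct (base_Int_part i) as [Hi1 Hi2]. destruct (base_Int_part j) as [Hj1 Hj2].
    set (zi := Int_part i) in *. set (zj := Int_part j) in *.
    destruct k; cbn [height fst snd] in *.
    - exists (IZR zi, IZR n), (IZR zi + 1, IZR n). cbn [fst snd].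
      split; [split; eexists; reflexivity|].
      split; [split; [exists (zi + 1)%Z; now rewrite plus_IZR|now exists n]|].
      split; [field|]. exists (i - IZR zi). split; [lra|].
      apply injective_projections; cbn [fst snd]; lra.
    - exists (IZR n, IZR zj), (IZR n, IZR zj + 1). cbn [fst snd].
      split; [split; eexists; reflexivity|].
      split; [split; [now exists n|exists (zj + 1)%Z; now rewrite plus_IZR]|].
      split; [field|]. exists (j - IZR zj). split; [lra|].
      apply injective_projections; cbn [fst snd]; lra.
    - exists (IZR zi, IZR n - IZR zi), (IZR zi + 1, IZR n - IZR zi - 1). cbn [fst snd].
      split; [split; [now exists zi|exists (n - zi)%Z; now rewrite minus_IZR]|].
      split; [split; [exists (zi + 1)%Z; now rewrite plus_IZR|exists (n - zi - 1)%Z; now rewrite !minus_IZR]|].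
      split; [field|]. exists (i - IZR zi). split; [lra|].
      apply injective_projections; cbn [fst snd]; lra. }
  destruct H as (P & Q & HP & HQ & HPQ & HX).
  exists (emb o s P), (emb o s Q). rewrite tess_edge_coord, !coord_emb by exact Hs.
  split; [auto|]. now apply on_segment_emb.
Qed.

(** Induction on the number of strikes, with [unfolded_next] at each of them. The
    hypothesis on the edge number k + 1 may use that the unfolded strike point is on the
    line: an unfolding that is given satisfies it outright, and for an unfolding still to
    be constructed the edges are chosen through the points of the line. *)
Lemma unfold_map_line ob m t E F v :
  lattice_billiard (fun t => co (path ob t)) ->
  departs (fun t => co (path ob t)) (start ob) v ->
  strike_times T ob m t ->
  (forall k, (S k < m)%nat ->
     co (unfold_map E F k (path ob (t (S k)))) =
       line (co (path ob (start ob))) v (t (S k) - start ob) ->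
     tess_edge T (E (S k)) (F (S k)) /\
     on_segment (E (S k)) (F (S k)) (unfold_map E F k (path ob (t (S k))))) ->
  forall k r, (k < m)%nat -> t k <= r <= t (S k) ->
    co (unfold_map E F k (path ob r)) = line (co (path ob (start ob))) v (r - start ob).
Proof.
  intros B Hv (Ht0 & Htm & Hinc & Hst) HEF.
  set (beta := fun t => co (path ob t)) in *.
  set (X := beta (start ob)).
  assert (Hmono : forall i j, (i <= j <= m)%nat -> t i <= t j).
  { intros i j [Hij Hj]. induction Hij as [|j Hij IH]; [lra|].
    pose proof (Hinc j ltac:(lia)). specialize (IH ltac:(lia)). lra. }
  assert (Hbd : forall r, boundary T (path ob r) <-> exists k, isZ (height k (beta r))).
  { intro r. apply (boundary_height); [apply (lb_tile _ B)|apply (lb_vertex _ B)]. }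
  assert (Hfree : forall k r, (k < m)%nat -> t k < r < t (S k) ->
     forall f, ~ isZ (height f (beta r))).
  { intros k r Hk Hr f Hf.
    assert (Hrb : boundary T (path ob r)) by (apply Hbd; now exists f).
    apply Hst in Hrb.
    - destruct Hrb as (k' & Hk' & ->).
      destruct (Nat.le_gt_cases k' k).
      + pose proof (Hmono k' k ltac:(lia)). lra.
      + pose proof (Hmono (S k) k' ltac:(lia)). lra.
    - pose proof (Hmono 0%nat k ltac:(lia)). pose proof (Hmono (S k) m ltac:(lia)). lra. }
  assert (Hw : forall k, (k < m)%nat -> exists w,
     (forall Y, co (unfold_map E F k Y) = wact w (co Y)) /\
     unfolded_by beta w X v (start ob) (t k)).
  { induction k as [|k IH]; intro Hk.
    - exists (Weyl Lid 0 0). split.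
      + intro Y. cbn [unfold_map]. generalize (co Y). intro. point_ring.
      + rewrite Ht0. split.
        * fold X. unfold line. generalize X. intro. point_ring.
        * intros v' Hv'. rewrite (departs_unique _ _ _ _ Hv' Hv). now destruct v.
    - destruct (IH ltac:(lia)) as (w & Hw1 & Hw2).
      pose proof (unfolded_flight beta w X v (start ob) (t k) (t (S k)) (t (S k)) B Hw2
        (Hinc k ltac:(lia)) (fun r Hr => Hfree k r ltac:(lia) Hr)
        ltac:(pose proof (Hinc k ltac:(lia)); lra)) as Hfl.
      destruct (HEF k Hk) as [Hedge Hon].
      { rewrite Hw1. exact Hfl. }
      destruct (tess_edge_reflect _ _ Hedge) as (f & n & Hrefl & Hline).
      specialize (Hline _ Hon). rewrite Hw1 in Hline.
      change (co (path ob (t (S k)))) with (beta (t (S k))) in Hline. rewrite Hfl in Hline.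
      destruct (wact_compose (mirror_in f n) w) as (w' & H1 & H2).
      exists w'. split.
      + intro Y. cbn [unfold_map]. now rewrite Hrefl, Hw1, H1.
      + apply (unfolded_next beta w X v (start ob) (t k) (t (S k)) f n w' B Hw2); trivial.
        * apply Hinc. lia.
        * intros r Hr. apply (Hfree k); [lia|exact Hr].
        * intro x. now rewrite H2, lin_mirror_in. }
  intros k r Hk Hr. destruct (Hw k Hk) as (w & Hw1 & Hw2). rewrite Hw1.
  apply (unfolded_flight beta w X v (start ob) (t k) (t (S k)) r B Hw2); trivial.
  - now apply Hinc.
  - intros r' Hr'. now apply (Hfree k).
Qed.

Lemma unfolds_to_vector ob v P Q :
  lattice_billiard (fun t => co (path ob t)) ->
  departs (fun t => co (path ob t)) (start ob) v ->
  start ob < stop ob -> path ob (stop ob) = path ob (start ob) ->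
  unfolds_to T ob P Q ->
  P = path ob (start ob) /\ sub Q P = emb_vec s (scale (stop ob - start ob) v).
Proof.
  intros B Hv Hlt Hret (m & t & E & F & Hst & HEF & -> & ->). split; [reflexivity|].
  pose proof Hst as (Ht0 & Htm & Hinc & _).
  destruct m as [|m]; [exfalso; lra|].
  replace (S m - 1)%nat with m by lia.
  assert (H : co (unfold_map E F m (path ob (stop ob))) =
     line (co (path ob (start ob))) v (stop ob - start ob)).
  { apply (unfold_map_line ob (S m) t E F v); trivial.
    - intros k Hk _. now apply HEF.
    - lia.
    - rewrite Htm. pose proof (Hinc m ltac:(lia)). lra. }
  rewrite Hret in H. rewrite sub_coord, H. f_equal. unfold line.
  generalize (co (path ob (start ob))). intro. point_ring.
Qed.

Lemma unfolds_to_exists ob v m t :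
  lattice_billiard (fun t => co (path ob t)) ->
  departs (fun t => co (path ob t)) (start ob) v ->
  strike_times T ob m t ->
  exists Q, unfolds_to T ob (path ob (start ob)) Q.
Proof.
  intros B Hv Hst.
  set (L := fun r => line (co (path ob (start ob))) v (r - start ob)).
  assert (Hch : forall k, exists EF : point * point, (S k < m)%nat ->
     tess_edge T (fst EF) (snd EF) /\ on_segment (fst EF) (snd EF) (emb o s (L (t (S k))))).
  { intro k. destruct (Nat.lt_ge_cases (S k) m) as [Hk|Hk].
    - assert (Hz : exists f, isZ (height f (L (t (S k))))).
      { apply (strike_on_line _ _ _ (t (S k)) B Hv).
        apply (boundary_height (path ob (t (S k)))); [apply (lb_tile _ B)|apply (lb_vertex _ B)|].
        destruct Hst as (Ht0 & Htm & Hinc & Hst).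
        assert (Hmono : forall i j, (i <= j <= m)%nat -> t i <= t j).
        { intros i j [Hij Hj]. induction Hij as [|j Hij IH]; [lra|].
          pose proof (Hinc j ltac:(lia)). specialize (IH ltac:(lia)). lra. }
        apply Hst.
        - rewrite <- Ht0, <- Htm. split; apply Hmono; lia.
        - exists (S k). split; [lia|reflexivity]. }
      destruct Hz as (f & n & Hn).
      destruct (tess_edge_through (emb o s (L (t (S k)))) f n) as (E & F & H1 & H2).
      { now rewrite coord_emb. }
      exists (E, F). intros _. now split.
    - (* a default value beyond the last edge *)
      exists (o, o). lia. }
  set (EF := fun k => proj1_sig (constructive_indefinite_description _ (Hch k))).
  assert (HEF : forall k, (S k < m)%nat -> tess_edge T (fst (EF k)) (snd (EF k)) /\
     on_segment (fst (EF k)) (snd (EF k)) (emb o s (L (t (S k))))).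
  { intro k. exact (proj2_sig (constructive_indefinite_description _ (Hch k))). }
  (* edges are numbered from 1, so [EF k] is the edge number [S k] *)
  set (E := fun k => fst (EF (pred k))). set (F := fun k => snd (EF (pred k))).
  assert (HU : forall k, (S k < m)%nat ->
     co (unfold_map E F k (path ob (t (S k)))) = L (t (S k)) ->
     tess_edge T (E (S k)) (F (S k)) /\
     on_segment (E (S k)) (F (S k)) (unfold_map E F k (path ob (t (S k))))).
  { intros k Hk Hl. rewrite <- (emb_coord o s (unfold_map _ _ _ _) Hs), Hl.
    now apply HEF. }
  eexists. exists m, t, E, F. split; [exact Hst|]. split; [|split; reflexivity].
  intros k Hk. apply HU; [exact Hk|].
  apply (unfold_map_line ob m t E F v B Hv Hst HU); [lia|].
  destruct Hst as (_ & _ & Hinc & _). pose proof (Hinc k ltac:(lia)). lra.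
Qed.

(** The cosine of the angle with the base is (u1 + u2 / 2) / |u| up to sign. *)
Lemma line_angle_base u : u <> (0, 0) ->
  (PI / 6 <= line_angle (emb_vec s u) (sub (vC T) (vB T)) <= PI / 3 <->
   bil u u <= 4 * ((fst u + snd u / 2) * (fst u + snd u / 2)) <= 3 * bil u u).
Proof.
  intro Hu. pose proof (bil_pos u Hu) as Hp. set (y := fst u + snd u / 2).
  assert (Hd : exists c, (c = 1 \/ c = -1) /\ sub (vC T) (vB T) = emb_vec s (c, 0)).
  { pose proof HT as (_ & _ & [[-> ->]|[-> ->]]).
    - exists 1. split; [now left|]. rewrite sub_emb. f_equal. unfold sub; cbn [fst snd]; f_equal; ring.
    - exists (-1). split; [now right|]. rewrite sub_emb. f_equal. unfold sub; cbn [fst snd]; f_equal; ring. }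
  destruct Hd as (c & Hc & ->).
  unfold line_angle. rewrite dot_emb, !norm_emb by exact Hs.
  assert (E1 : bil (c, 0) (c, 0) = 1).
  { unfold bil; cbn [fst snd]. destruct Hc as [-> | ->]; field. }
  assert (E2 : Rabs (s * s * bil u (c, 0)) = s * s * Rabs y).
  { replace (bil u (c, 0)) with (c * y) by (unfold bil, y; cbn [fst snd]; field).
    rewrite !Rabs_mult, (Rabs_right s) by lra.
    destruct Hc as [-> | ->]; [rewrite Rabs_R1|rewrite (Rabs_left (-1)) by lra]; ring. }
  rewrite E1, E2, sqrt_1.
  set (N := sqrt (bil u u)). assert (HN : 0 < N) by now apply sqrt_lt_R0.
  assert (HNN : N * N = bil u u) by (apply sqrt_sqrt; lra).
  replace (s * s * Rabs y / (s * N * (s * 1))) with (Rabs y / N) by (field; split; lra).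
  set (x := Rabs y / N).
  assert (Hxx : x * x * bil u u = y * y).
  { unfold x. rewrite <- HNN. replace (y * y) with (Rabs y * Rabs y).
    - field. lra.
    - rewrite <- Rabs_mult. apply Rabs_right, Rle_ge, Rle_0_sqr. }
  assert (Hx0 : 0 <= x).
  { unfold x. apply Rmult_le_pos; [apply Rabs_pos|]. apply Rlt_le, Rinv_0_lt_compat, HN. }
  assert (Hyb : y * y <= bil u u).
  { unfold y, bil. assert (0 <= snd u * snd u) by apply Rle_0_sqr. lra. }
  assert (Hx1 : x <= 1).
  { apply Rnot_lt_le. intro H. assert (1 < x * x) by nra. nra. }
  rewrite angle_window by lra. rewrite <- Hxx. split; intros [H1 H2]; split; nra.
Qed.

Lemma base_coord X : on_segment (vB T) (vC T) X <-> in_tile (co X) /\ gap FBC (co X) = 0.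
Proof.
  apply (side_of_on_segment o s FBC); [exact Hs|].
  pose proof HT as (_ & _ & [[-> ->]|[-> ->]]); [left|right]; split; reflexivity.
Qed.

(** By the reflection law the arriving velocity is the mirror image of the departing
    velocity (p, q), and the two bounds on the angle become p (p + q) >= 0 and
    (p - q) (p + 2q) <= 0. *)
Lemma normal_start_coord ob :
  lattice_billiard (fun t => co (path ob t)) ->
  (normal_start T ob <->
   snd (co (path ob (start ob))) = 0 /\
   exists v, departs (fun t => co (path ob t)) (start ob) v /\ in_sector v).
Proof.
  intro B. set (beta := fun t => co (path ob t)) in *.
  pose proof sqrt3_pos as H3.
  destruct (lb_law _ B (start ob)) as (u & v & Hu & Hv & Hv0 & _ & Hon).
  pose proof (departs_emb o s (path ob) _ _ Hs Hv) as HvT.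
  pose proof (arrives_emb o s (path ob) _ _ Hs Hu) as HuT.
  assert (Hmir : snd (beta (start ob)) = 0 -> u = lact (Lmir FBC) v).
  { intro H0. rewrite (Hon FBC); [now rewrite mirror_involutive|]. now exists 0%Z. }
  assert (Hu0 : snd (beta (start ob)) = 0 -> u <> (0, 0)).
  { intros H0 E. apply Hv0. rewrite (Hon FBC), E; [cbn [lact]; f_equal; ring|]. now exists 0%Z. }
  unfold normal_start. rewrite base_coord. change (co (path ob (start ob))) with (beta (start ob)).
  change (gap FBC (beta (start ob))) with (snd (beta (start ob))). split.
  - intros [[_ H0] [(u' & Hu' & Hang) (v' & Hv' & Hx & Hy)]].
    split; [exact H0|]. exists v. split; [exact Hv|].
    rewrite (arrives_unique _ _ _ _ Hu' HuT) in Hang.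
    rewrite (departs_unique _ _ _ _ Hv' HvT) in Hx, Hy.
    apply (line_angle_base u (Hu0 H0)) in Hang. rewrite (Hmir H0) in Hang.
    destruct v as [p q]. unfold emb_vec, bil, in_sector in *; cbn [lact fst snd] in *.
    assert (Hq : 0 < q).
    { apply (Rmult_lt_reg_l (s * (sqrt 3 / 2))); [apply Rmult_lt_0_compat; lra|lra]. }
    assert (Hpq : 0 < p + q / 2) by (apply (Rmult_lt_reg_l s); lra).
    assert (H1 : 0 <= p * (p + q)) by lra.
    assert (H2 : (p - q) * (p + 2 * q) <= 0) by lra.
    split; [split|exact Hq].
    + apply Rnot_lt_le. intro. nra.
    + apply Rnot_lt_le. intro. nra.
  - intros [H0 (v' & Hv' & Hsec)]. rewrite (departs_unique _ _ _ _ Hv' Hv) in Hsec.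
    split; [|split].
    + split; [apply (lb_tile _ B)|exact H0].
    + exists (emb_vec s u). split; [exact HuT|]. apply (line_angle_base u (Hu0 H0)).
      rewrite (Hmir H0). destruct v as [p q]. unfold bil, in_sector in *; cbn [lact fst snd] in *.
      nra.
    + exists (emb_vec s v). split; [exact HvT|]. destruct v as [p q].
      unfold emb_vec, in_sector in *; cbn [fst snd] in *.
      split; repeat apply Rmult_lt_0_compat; lra.
Qed.

Lemma periodic_path ob t :
  periodic_orbit T ob -> path ob (t + (stop ob - start ob)) = path ob t.
Proof.
  intros (_ & _ & H). specialize (H (t - start ob)).
  replace (start ob + (t - start ob)) with t in H by ring. rewrite H. f_equal. ring.
Qed.

(** A symmetry of the triangle, a change of initial point and a reversal of time
    preserve trajectories, and change velocities within their congruence class. After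
    reversal the departing velocity is the opposite of an arriving one. *)
Lemma renormalized_billiard ob ob' :
  periodic_orbit T ob -> renormalized T ob ob' ->
  lattice_billiard (fun t => co (path ob' t)) /\
  path ob' (stop ob') = path ob' (start ob') /\
  start ob' < stop ob' /\
  (forall t t' v v', departs (fun t => co (path ob t)) t v ->
     departs (fun t => co (path ob' t)) t' v' -> congruent_vel v v').
Proof.
  intros Hper (g & Hg & Hpath & Hlen).
  pose proof (trajectory_coord _ (proj1 Hper)) as B.
  destruct (triangle_symmetry_coord g Hg) as [l Hl].
  assert (Hlt : start ob' < stop ob') by (destruct Hper as (_ & H & _); lra).
  set (len := stop ob - start ob) in *.
  assert (Hcong : forall v, congruent_vel v (scale (tsign l) (lact l v))).
  { intro v. exists l, (tsign l). split; [apply tsign_cases|reflexivity]. }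
  destruct Hpath as [Hpath|Hpath].
  - assert (E : (fun t => co (path ob' t)) = (fun t => tile_sym l (co (path ob t)))).
    { apply functional_extensionality. intro t. now rewrite Hpath, Hl. }
    rewrite E. split; [now apply (billiard_tile_sym l (fun t => co (path ob t)))|].
    split; [|split; [exact Hlt|]].
    + rewrite !Hpath. f_equal. rewrite <- (periodic_path ob (start ob') Hper). f_equal.
      fold len. lra.
    + intros t t' v v' Hv Hv'.
      destruct (billiard_departs _ t' B) as [v1 Hv1].
      rewrite (departs_unique _ _ _ _ Hv' (departs_tile_sym l _ t' v1 Hv1)).
      eapply congruent_vel_trans; [|apply Hcong].
      exact (billiard_velocities_congruent _ _ _ _ _ B Hv Hv1).
  - assert (E : (fun t => co (path ob' t)) = (fun t => tile_sym l (co (path ob (- t))))).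
    { apply functional_extensionality. intro t. now rewrite Hpath, Hl. }
    rewrite E.
    pose proof (billiard_reverse _ B) as Br. cbn beta in Br.
    split; [now apply (billiard_tile_sym l (fun t => co (path ob (- t))))|].
    split; [|split; [exact Hlt|]].
    + rewrite !Hpath. f_equal. rewrite <- (periodic_path ob (- stop ob') Hper). f_equal.
      fold len. lra.
    + intros t t' v v' Hv Hv'.
      destruct (lb_law _ B (- t')) as (u1 & v1 & Hu1 & Hv1 & _).
      pose proof (reverse_departs (fun t => co (path ob t)) t' u1 Hu1) as Hr. cbn beta in Hr.
      rewrite (departs_unique _ _ _ _ Hv' (departs_tile_sym l _ t' _ Hr)).
      eapply congruent_vel_trans; [|apply Hcong].
      eapply congruent_vel_trans; [exact (billiard_velocities_congruent _ _ _ _ _ B Hv Hv1)|].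
      eapply congruent_vel_trans; [exact (arrival_congruent _ _ _ _ B Hu1 Hv1)|].
      exists Lid, (-1). split; [now right|]. now destruct u1.
Qed.

(** The vector is the duration times a velocity in the sector, and the congruence
    class of this velocity is an invariant of the orbit. *)
Lemma unfolding_vector ob P Q :
  periodic_orbit T ob -> unfolding T ob P Q ->
  snd (co P) = 0 /\ exists v, in_sector v /\
    sub Q P = emb_vec s (scale (stop ob - start ob) v) /\
    forall t w, departs (fun t => co (path ob t)) t w -> congruent_vel w v.
Proof.
  intros Hper (ob' & Hren & Hns & Hunf).
  destruct (renormalized_billiard ob ob' Hper Hren) as (B & Hret & Hlt & Hcong).
  apply (normal_start_coord ob' B) in Hns. destruct Hns as (H0 & v & Hv & Hsec).
  destruct (unfolds_to_vector ob' v P Q B Hv Hlt Hret Hunf) as [-> Hvec].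
  split; [exact H0|]. exists v. split; [exact Hsec|]. split.
  - destruct Hren as (g & _ & _ & Hlen). now rewrite Hvec, Hlen.
  - intros t w Hw. exact (Hcong t _ w v Hw Hv).
Qed.

Lemma unfolding_vector_unique ob P Q P' Q' :
  periodic_orbit T ob -> unfolding T ob P Q -> unfolding T ob P' Q' ->
  sub Q P = sub Q' P'.
Proof.
  intros Hper H H'.
  destruct (unfolding_vector ob P Q Hper H) as (_ & v & Hv & -> & Hc).
  destruct (unfolding_vector ob P' Q' Hper H') as (_ & v' & Hv' & -> & Hc').
  do 2 f_equal. apply sector_unique; trivial.
  pose proof (trajectory_coord _ (proj1 Hper)) as B.
  destruct (billiard_departs _ 0 B) as [w Hw].
  eapply congruent_vel_trans; [apply congruent_vel_sym, (Hc 0 w Hw)|exact (Hc' 0 w Hw)].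
Qed.

Lemma normal_unfolding ob v l :
  lattice_billiard (fun t => co (path ob t)) ->
  start ob < stop ob -> path ob (stop ob) = path ob (start ob) ->
  snd (co (path ob (start ob))) = 0 ->
  departs (fun t => co (path ob t)) (start ob) v ->
  NoDup l -> (forall t, In t l <-> (start ob <= t < stop ob /\ boundary T (path ob t))) ->
  exists P Q, unfolds_to T ob P Q /\ sub Q P = emb_vec s (scale (stop ob - start ob) v).
Proof.
  intros B Hlt Hret H0 Hv ND Hl.
  assert (Hb : boundary T (path ob (start ob))).
  { apply (boundary_height); [apply (lb_tile _ B)|apply (lb_vertex _ B)|].
    exists FBC. now exists 0%Z. }
  destruct (strike_times_exist T ob l ND Hl Hlt Hb) as (m & t & Hst); [now rewrite Hret|].
  destruct (unfolds_to_exists ob v m t B Hv Hst) as [Q HQ].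
  exists (path ob (start ob)), Q. split; [exact HQ|].
  now apply (unfolds_to_vector ob v _ _ B Hv Hlt Hret HQ).
Qed.

Lemma boundary_path ob t :
  lattice_billiard (fun t => co (path ob t)) ->
  (boundary T (path ob t) <-> exists k, isZ (height k (co (path ob t)))).
Proof.
  intro B. apply (boundary_height); [apply (lb_tile _ B)|apply (lb_vertex _ B)].
Qed.

Lemma strikes_list ob v t0 a c :
  lattice_billiard (fun t => co (path ob t)) ->
  departs (fun t => co (path ob t)) t0 v -> in_sector v -> start ob < stop ob ->
  scale (stop ob - start ob) v = (INR a, INR c) ->
  exists l, NoDup l /\ length l = (2 * (a + c))%nat /\
    forall t, In t l <-> (start ob <= t < stop ob /\ boundary T (path ob t)).
Proof.
  intros B Hv Hsec Hlt Hvec.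
  destruct (count_strikes (co (path ob t0)) v t0 (stop ob - start ob) (start ob) a c)
    as (l & ND & Hlen & Hl); [exact Hsec|lra| |exact Hvec|].
  { intro t. apply (strike_on_line _ t0 v t B Hv). }
  exists l. split; [exact ND|]. split; [exact Hlen|]. intro t.
  rewrite Hl, boundary_path by exact B. unfold strikes.
  rewrite <- (proj1 (strike_on_line _ t0 v t B Hv)).
  replace (start ob + (stop ob - start ob)) with (stop ob) by ring. reflexivity.
Qed.

(** No reversal of time is needed to normalize the orbit, so both orbits have the
    same strike times, and the strikes counted by the period of the given orbit can be
    compared with those of the normalized one over another window of the same length. *)
Lemma unfolding_exists ob n :
  periodic_orbit T ob -> has_period T ob (2 * n) ->
  exists P Q a b, unfolding T ob P Q /\ (2 * a + 3 * b = n)%nat /\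
    sub Q P = emb_vec s (INR a, INR (a + 3 * b)).
Proof.
  intros Hper (lst & ND & Hlen & Hlst).
  pose proof (trajectory_coord _ (proj1 Hper)) as B.
  pose proof (proj1 (proj2 Hper)) as Hlt.
  destruct (normal_start_time _ B) as (t0 & l & v & Hv & H0 & Hsec).
  set (len := stop ob - start ob).
  set (g := fun X => emb o s (tile_sym l (co X))).
  set (ob' := Orbit (fun t => g (path ob t)) t0 (t0 + len)).
  set (beta' := fun t => tile_sym l (co (path ob t))).
  assert (E : (fun t => co (path ob' t)) = beta').
  { apply functional_extensionality. intro t. cbn [path ob']. unfold g.
    now rewrite coord_emb. }
  pose proof (billiard_tile_sym l _ B) as B'. cbn beta in B'. fold beta' in B'.
  pose proof (departs_tile_sym l _ t0 v Hv) as Hv'. cbn beta in Hv'. fold beta' in Hv'.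
  set (v' := scale (tsign l) (lact l v)) in *.
  assert (Hlen' : stop ob' - start ob' = len) by (cbn [start stop ob']; ring).
  assert (Hshift : forall t, path ob' (t + len) = path ob' t).
  { intro t. cbn [path ob']. f_equal. now apply periodic_path. }
  assert (Hbd : forall t, boundary T (path ob t) <-> exists k, isZ (height k (beta' t))).
  { intro t. rewrite boundary_path by exact B. split; intros [k Hk].
    - destruct (lfam_surj l k) as [k' <-]. exists k'. now apply isZ_height_tile_sym.
    - exists (lfam l k). now apply isZ_height_tile_sym. }
  assert (Hshift' : forall t, beta' (t + len) = beta' t).
  { intro t. unfold beta', len. now rewrite periodic_path. }
  assert (HvR : departs beta' (t0 + len) v').
  { destruct Hv' as (e & He & H). exists e. split; [exact He|]. intros h Hh.
    replace (t0 + len + h) with (t0 + h + len) by ring. rewrite !Hshift'. now apply H. }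
  destruct (period_vector beta' t0 v' len (start ob) lst n) as (a & b & Hab & Hvec);
    trivial; [unfold len; lra| |].
  { intro t. rewrite Hlst, Hbd.
    replace (start ob + len) with (stop ob) by (unfold len; ring). reflexivity. }
  destruct (strikes_list ob' v' t0 a (a + 3 * b)) as (l2 & ND2 & _ & Hl2).
  { now rewrite E. } { now rewrite E. } { exact Hsec. }
  { cbn [start stop ob']. unfold len; lra. } { now rewrite Hlen'. }
  destruct (normal_unfolding ob' v' l2) as (P & Q & HPQ & Hsub); trivial.
  { now rewrite E. } { cbn [start stop ob']. unfold len; lra. }
  { exact (Hshift t0). } { change (snd ((fun t => co (path ob' t)) t0) = 0). now rewrite E. }
  { now rewrite E. }
  exists P, Q, a, b. split; [|split; [exact Hab|]].
  - exists ob'. split; [|split; [|exact HPQ]].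
    + exists g. split; [now apply tile_sym_symmetry|]. split; [left; reflexivity|exact Hlen'].
    + apply (normal_start_coord); rewrite E; [exact B'|]. split.
      * change (snd ((fun t => co (path ob' t)) t0) = 0). now rewrite E.
      * exists v'. now split.
  - now rewrite Hsub, Hlen', Hvec.
Qed.

Lemma orbit_exists a b n : (1 <= n)%nat -> (2 * a + 3 * b = n)%nat ->
  exists ob P Q, periodic_orbit T ob /\ has_period T ob (2 * n) /\
    unfolding T ob P Q /\ sub Q P = emb_vec s (INR a, INR (a + 3 * b)).
Proof.
  intros Hn Hab.
  destruct (periodic_billiard_exists a b) as (beta & B & Hper & H0 & Hv & Hdir); [lia|].
  set (V := (INR a, INR (a + 3 * b))) in *.
  set (ob := Orbit (fun t => emb o s (beta t)) 0 1).
  assert (E : (fun t => co (path ob t)) = beta).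
  { apply functional_extensionality. intro t. cbn [path ob]. now apply coord_emb. }
  assert (Hsec : in_sector V).
  { unfold in_sector, V; cbn [fst snd].
    pose proof (pos_INR a). pose proof (le_INR a (a + 3 * b) ltac:(lia)).
    pose proof (lt_INR 0 (a + 3 * b) ltac:(lia)) as H1p. change (INR 0) with 0 in H1p. lra. }
  assert (Hsc : scale (stop ob - start ob) V = V).
  { cbn [start stop ob]. unfold scale, V; cbn [fst snd]. f_equal; ring. }
  assert (Hlt : start ob < stop ob) by (cbn [start stop ob]; lra).
  assert (Hret : path ob (stop ob) = path ob (start ob)).
  { cbn [path start stop ob]. f_equal. rewrite <- (Hper 0). f_equal. ring. }
  assert (H0' : snd (co (path ob (start ob))) = 0).
  { change (snd ((fun t => co (path ob t)) 0) = 0). now rewrite E. }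
  destruct (strikes_list ob V 0 a (a + 3 * b)) as (l & ND & Hlen & Hl); trivial;
    [now rewrite E|now rewrite E|].
  destruct (normal_unfolding ob V l) as (P & Q & HPQ & Hsub); trivial;
    [now rewrite E|now rewrite E|].
  exists ob, P, Q. split; [|split; [|split]].
  - split; [now apply (trajectory_emb beta V)|]. split; [exact Hlt|].
    intro t. cbn [path start stop ob]. f_equal. rewrite <- (Hper (0 + t)). f_equal. ring.
  - exists l. split; [exact ND|]. split; [lia|exact Hl].
  - exists ob. split; [|split; [|exact HPQ]].
    + exists (fun X => X). split; [split; auto|]. split; [left; reflexivity|reflexivity].
    + apply (normal_start_coord); rewrite E; [exact B|]. split; [exact H0'|].
      exists V. now split.
  - now rewrite Hsub, Hsc.
Qed.

Lemma snd_coord_base P : snd (co P) = 0 <-> snd P = snd o.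
Proof.
  pose proof sqrt3_pos. split; intro H0.
  - rewrite <- (emb_coord o s P Hs). unfold emb, emb_vec, add; cbn [fst snd]. rewrite H0. ring.
  - unfold coord, coord_vec, sub; cbn [fst snd]. rewrite H0. unfold Rdiv. ring.
Qed.

(** All unfoldings start on the line of the base, so unfoldings with the same vector
    differ by a horizontal translation. *)
Lemma same_vector_same_class ob1 ob2 P1 Q1 P2 Q2 :
  periodic_orbit T ob1 -> periodic_orbit T ob2 ->
  unfolding T ob1 P1 Q1 -> unfolding T ob2 P2 Q2 -> sub Q1 P1 = sub Q2 P2 ->
  orbit_class T ob1 = orbit_class T ob2.
Proof.
  assert (Hone : forall ob1 ob2 P1 Q1 P2 Q2 ob,
    periodic_orbit T ob1 -> periodic_orbit T ob2 ->
    unfolding T ob1 P1 Q1 -> unfolding T ob2 P2 Q2 -> sub Q1 P1 = sub Q2 P2 ->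
    orbit_class T ob1 ob -> orbit_class T ob2 ob).
  { clear ob1 ob2 P1 Q1 P2 Q2. intros ob1 ob2 P1 Q1 P2 Q2 ob Hp1 Hp2 H1 H2 E
      [Hp (P & Q & R' & S' & HPQ & HRS & h & ER & ES)].
    split; [exact Hp|]. exists P2, Q2, R', S'. split; [exact H2|]. split; [exact HRS|].
    pose proof (unfolding_vector_unique ob1 _ _ _ _ Hp1 H1 HPQ) as EU. rewrite E in EU.
    destruct (unfolding_vector ob2 P2 Q2 Hp2 H2) as [HB2 _]. apply snd_coord_base in HB2.
    destruct (unfolding_vector ob R' S' Hp HRS) as [HB _]. apply snd_coord_base in HB.
    exists (fst R' - fst P2). subst R' S'.
    destruct P, Q, P2, Q2. unfold add, sub in *; cbn [fst snd] in *. injection EU as E1 E2.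
    split; apply injective_projections; cbn [fst snd]; lra. }
  intros Hp1 Hp2 H1 H2 E. apply functional_extensionality. intro ob.
  apply propositional_extensionality. split.
  - now apply (Hone ob1 ob2 P1 Q1 P2 Q2).
  - now apply (Hone ob2 ob1 P2 Q2 P1 Q1).
Qed.

Lemma same_class_same_vector ob1 ob2 P1 Q1 P2 Q2 :
  periodic_orbit T ob1 -> periodic_orbit T ob2 ->
  unfolding T ob1 P1 Q1 -> unfolding T ob2 P2 Q2 ->
  orbit_class T ob1 = orbit_class T ob2 -> sub Q1 P1 = sub Q2 P2.
Proof.
  intros Hp1 Hp2 H1 H2 E.
  assert (H : orbit_class T ob2 ob1).
  { rewrite <- E. split; [exact Hp1|]. exists P1, Q1, P1, Q1.
    split; [exact H1|]. split; [exact H1|]. exists 0.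
    split; [destruct P1|destruct Q1]; point_ring. }
  destruct H as (_ & P & Q & R' & S' & HPQ & HRS & h & ER & ES).
  rewrite (unfolding_vector_unique ob1 _ _ _ _ Hp1 H1 HRS).
  rewrite (unfolding_vector_unique ob2 _ _ _ _ Hp2 H2 HPQ).
  subst. destruct P, Q. point_ring.
Qed.

End Frame.

(** * Partitions into parts 2 and 3 *)

Definition threes_twos (a b : nat) : nat -> nat :=
  fun i => if (i <? b)%nat then 3%nat else if (i <? b + a)%nat then 2%nat else 0%nat.

(** Stated as a disjunction that linear arithmetic can use. *)
Lemma threes_twos_cases a b i :
  (i < b /\ threes_twos a b i = 3 \/ b <= i < b + a /\ threes_twos a b i = 2 \/
   b + a <= i /\ threes_twos a b i = 0)%nat.
Proof.
  unfold threes_twos. destruct (Nat.ltb_spec i b); [auto|].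
  destruct (Nat.ltb_spec i (b + a)); auto.
Qed.

Lemma list_sum_const (f : nat -> nat) c i m :
  (forall j, (i <= j < i + m)%nat -> f j = c) -> list_sum (map f (seq i m)) = (c * m)%nat.
Proof.
  revert i. induction m as [|m IH]; intros i H; simpl.
  - lia.
  - rewrite IH by (intros; apply H; lia). rewrite H by lia. lia.
Qed.

Lemma threes_twos_sum a b N : (b + a <= N)%nat ->
  list_sum (map (threes_twos a b) (seq 0 N)) = (2 * a + 3 * b)%nat.
Proof.
  intro H. replace N with (b + (a + (N - (b + a))))%nat by lia.
  rewrite !seq_app, !map_app, !list_sum_app, (list_sum_const _ 3), (list_sum_const _ 2), (list_sum_const _ 0).
  - lia.
  - intros j Hj. pose proof (threes_twos_cases a b j). lia.
  - intros j Hj. pose proof (threes_twos_cases a b j). lia.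
  - intros j Hj. pose proof (threes_twos_cases a b j). lia.
Qed.

Lemma threes_twos_partition a b :
  is_partition (2 * a + 3 * b) (threes_twos a b) /\ parts_2_3 (threes_twos a b).
Proof.
  split; [split|].
  - intro i. pose proof (threes_twos_cases a b i). pose proof (threes_twos_cases a b (S i)). lia.
  - exists (b + a)%nat. split.
    + intros i Hi. pose proof (threes_twos_cases a b i). lia.
    + now apply threes_twos_sum.
  - intros i Hi. pose proof (threes_twos_cases a b i). lia.
Qed.

Lemma threes_twos_inj a b a' b' :
  threes_twos a b = threes_twos a' b' -> (2 * a + 3 * b = 2 * a' + 3 * b')%nat ->
  a = a' /\ b = b'.
Proof.
  intros E H. pose proof (f_equal (fun f => f b) E) as E1. pose proof (f_equal (fun f => f b') E) as E2.
  cbn beta in *.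
  pose proof (threes_twos_cases a b b). pose proof (threes_twos_cases a' b' b).
  pose proof (threes_twos_cases a b b'). pose proof (threes_twos_cases a' b' b'). lia.
Qed.

Lemma nonincreasing_threshold (p : nat -> nat) c N :
  (forall i, (p (S i) <= p i)%nat) -> (p N < c)%nat ->
  exists b, (b <= N)%nat /\ (forall i, (i < b)%nat -> (c <= p i)%nat) /\
            (forall i, (b <= i)%nat -> (p i < c)%nat).
Proof.
  intros Hdec. revert N. 
  assert (Hmono : forall i j, (i <= j)%nat -> (p j <= p i)%nat).
  { intros i j H. induction H as [|j H IH]; [lia|]. specialize (Hdec j). lia. }
  induction N as [|N IH]; intro HN.
  - exists 0%nat. split; [lia|]. split; [lia|]. intros i Hi. pose proof (Hmono 0%nat i Hi). lia.
  - destruct (Nat.lt_ge_cases (p N) c) as [H|H].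
    + destruct (IH H) as (b & Hb & H1). exists b. split; [lia|exact H1].
    + exists (S N). split; [lia|]. split.
      * intros i Hi. pose proof (Hmono i N ltac:(lia)). lia.
      * intros i Hi. pose proof (Hmono (S N) i Hi). lia.
Qed.

(** A nonincreasing sequence is at least 3 up to some index, and positive up to a
    later one. *)
Lemma partition_threes_twos n p : is_partition n p -> parts_2_3 p ->
  exists a b, (2 * a + 3 * b = n)%nat /\ p = threes_twos a b.
Proof.
  intros [Hdec (N & HN & Hsum)] Hparts.
  destruct (nonincreasing_threshold p 3 N Hdec) as (b & Hb & B1 & B2).
  { rewrite HN; lia. }
  destruct (nonincreasing_threshold p 1 N Hdec) as (d & Hd & D1 & D2).
  { rewrite HN; lia. }
  assert (Hbd : (b <= d)%nat).
  { apply Nat.nlt_ge. intro H. pose proof (B1 d H). pose proof (D2 d ltac:(lia)). lia. }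
  assert (E : p = threes_twos (d - b) b).
  { apply functional_extensionality. intro i.
    pose proof (threes_twos_cases (d - b) b i). pose proof (B1 i). pose proof (B2 i).
    pose proof (D1 i). pose proof (D2 i). specialize (Hparts i). lia. }
  exists (d - b)%nat, b. split; [|exact E].
  rewrite <- Hsum, E. symmetry. apply threes_twos_sum. lia.
Qed.

(** * The bijection *)

Lemma bijection_of_relation (X Y : Type) (R : X -> Y -> Prop) :
  (forall x, exists y, R x y) -> (forall y, exists x, R x y) ->
  (forall x y y', R x y -> R x y' -> y = y') ->
  (forall x x' y, R x y -> R x' y -> x = x') ->
  exists f : X -> Y, Bijective f.
Proof.
  intros HX HY Hf Hi.
  set (f := fun x => proj1_sig (constructive_indefinite_description _ (HX x))).
  set (g := fun y => proj1_sig (constructive_indefinite_description _ (HY y))).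
  assert (Rf : forall x, R x (f x)) by (intro x; exact (proj2_sig (constructive_indefinite_description _ (HX x)))).
  assert (Rg : forall y, R (g y) y) by (intro y; exact (proj2_sig (constructive_indefinite_description _ (HY y)))).
  exists f, g. split; intros; eauto.
Qed.

Lemma sig_eq (A : Type) (P : A -> Prop) (x y : {a | P a}) : proj1_sig x = proj1_sig y -> x = y.
Proof.
  destruct x as [x Hx], y as [y Hy]; cbn [proj1_sig]. intros ->. f_equal. apply proof_irrelevance.
Qed.

Theorem corollary4 (T : Triangle) (hT : equilateral_on_horizontal_base T)
    (n : nat) (hn : (1 <= n)%nat) :
  exists f : {c : orbit -> Prop | is_class_of_period T (2 * n) c} ->
             {p : nat -> nat | is_partition n p /\ parts_2_3 p},
    Bijective f.
Proof.
  destruct (framed_exists T hT) as (o & s & HT).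
  apply (bijection_of_relation _ _ (fun c p => exists a b ob P Q,
    (2 * a + 3 * b = n)%nat /\ proj1_sig p = threes_twos a b /\
    periodic_orbit T ob /\ proj1_sig c = orbit_class T ob /\ unfolding T ob P Q /\
    sub Q P = emb_vec s (INR a, INR (a + 3 * b)))).
  - intros [c (ob & Hper & Hm & Hc)].
    destruct (unfolding_exists T o s HT ob n Hper Hm) as (P & Q & a & b & HPQ & Hab & Hv).
    pose proof (threes_twos_partition a b) as Hp. rewrite Hab in Hp.
    exists (exist _ (threes_twos a b) Hp). exists a, b, ob, P, Q. now repeat (split; [first [assumption|reflexivity]|]).
  - intros [p [Hp1 Hp2]].
    destruct (partition_threes_twos n p Hp1 Hp2) as (a & b & Hab & Hp).
    destruct (orbit_exists T o s HT a b n hn Hab) as (ob & P & Q & Hper & Hm & HPQ & Hv).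
    exists (exist _ (orbit_class T ob) (ex_intro _ ob (conj Hper (conj Hm eq_refl)))).
    exists a, b, ob, P, Q. now repeat (split; [first [assumption|reflexivity]|]).
  - intros c p p' (a & b & ob & P & Q & Hab & Hp & Hper & Hc & HPQ & Hv)
      (a' & b' & ob' & P' & Q' & Hab' & Hp' & Hper' & Hc' & HPQ' & Hv').
    apply sig_eq. rewrite Hp, Hp'.
    assert (E : sub Q P = sub Q' P').
    { apply (same_class_same_vector T o s HT ob ob'); trivial. now rewrite <- Hc. }
    rewrite Hv, Hv' in E. apply (f_equal (coord_vec s)) in E.
    rewrite !coord_vec_emb in E by apply HT. injection E as E1 E2.
    apply INR_eq in E1, E2. f_equal; lia.
  - intros c c' p (a & b & ob & P & Q & Hab & Hp & Hper & Hc & HPQ & Hv)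
      (a' & b' & ob' & P' & Q' & Hab' & Hp' & Hper' & Hc' & HPQ' & Hv').
    apply sig_eq. rewrite Hc, Hc'. rewrite Hp in Hp'.
    apply threes_twos_inj in Hp' as [<- <-]; [|lia].
    apply (same_vector_same_class T o s HT ob ob' P Q P' Q'); trivial. congruence.
Qed.
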